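(* Let $s,t\geq 1$ be integers and let $p,q,l$ be three distinct primes with $p,q$ odd, $p\equiv 3 \pmod 4$, $\mathrm{ord}_{p^s}(l)=\phi(p^s)/2$, $\mathrm{ord}_{q^t}(l)=\phi(q^t)$ and $\gcd(\phi(p^s),\phi(q^t))=2$. Suppose that $q$ is a quadratic residue modulo $p$. Then the primitive idempotents $\theta_{ij},\theta_{ij}^*$ of $\mathbb{F}_l[x]/\langle x^{p^sq^t}-1\rangle$ are given as follows. (i) For $i=0$ and $j=t$, \[\theta_{0t}=\frac{1}{pq^t}\Big(\frac{p-1}{2}\sum_{0\leq m\leq t}\chi_{sm}+\mathscr{N}\sum_{0\leq m\leq t}\chi_{s-1,m}+\mathscr{R}\sum_{0\leq m\leq t}\chi_{s-1,m}^*\Big),\] \[\theta_{0t}^*=\frac{1}{pq^t}\Big(\frac{p-1}{2}\sum_{0\leq m\leq t}\chi_{sm}+\mathscr{R}\sum_{0\leq m\leq t}\chi_{s-1,m}+\mathscr{N}\sum_{0\leq m\leq t}\chi_{s-1,m}^*\Big).\] (ii) For $i=0$ and $0\leq j\leq t-1$, \[\begin{aligned} \theta_{0j}=\frac{1}{pq^{j+1}}\Big(&\frac{p-1}{2}(q-1)\sum_{t-j\leq m\leq t}\chi_{sm} +(q-1)\Big(\mathscr{N}\sum_{t-j\leq m\leq t}\chi_{s-1,m}+\mathscr{R}\sum_{t-j\leq m\leq t}\chi_{s-1,m}^*\Big)\\ &-\big(\mathscr{N}\chi_{s-1,t-j-1}+\mathscr{R}\chi_{s-1,t-j-1}^*\big)-\frac{p-1}{2}\chi_{s,t-j-1}\Big),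 \end{aligned}\] \[\begin{aligned} \theta_{0j}^*=\frac{1}{pq^{j+1}}\Big(&\frac{p-1}{2}(q-1)\sum_{t-j\leq m\leq t}\chi_{sm} +(q-1)\Big(\mathscr{R}\sum_{t-j\leq m\leq t}\chi_{s-1,m}+\mathscr{N}\sum_{t-j\leq m\leq t}\chi_{s-1,m}^*\Big)\\ &-\big(\mathscr{R}\chi_{s-1,t-j-1}+\mathscr{N}\chi_{s-1,t-j-1}^*\big)-\frac{p-1}{2}\chi_{s,t-j-1}\Big). \end{aligned}\] (iii) For $1\leq i\leq s-1$ and $0\leq j\leq t-1$, \[\begin{aligned} \theta_{ij}=\frac{1}{p^{i+1}q^{j+1}}\Big(&\frac{p-1}{2}(q-1)\Big(\sum_{\substack{s-i\leq k\leq s-1\\t-j\leq m\leq t}}(\chi_{km}+\chi_{km}^* )+\sum_{t-j\leq m\leq t}\chi_{sm}\Big)\\ &+(q-1)\Big(\mathscr{N}\sum_{t-j\leq m\leq t}\chi_{s-i-1,m}+\mathscr{R}\sum_{t-j\leq m\leq t}\chi_{s-i-1,m}^*\Big)\\ &-\big(\mathscr{N}\chi_{s-i-1,t-j-1}+\mathscr{R}\chi_{s-i-1,t-j-1}^*\big)\\ &-\frac{p-1}{2}\big(\chi_{s-i,t-j-1}+\chi_{s-i,t-j-1}^*\big)\Big), \end{aligned}\] \[\begin{aligned} \theta_{ij}^*=\frac{1}{p^{i+1}q^{j+1}}\Big(&\frac{p-1}{2}(q-1)\Big(\sum_{\substack{s-i\leq k\leq s-1\\t-j\leq m\leq t}}(\chi_{km}+\chi_{km}^*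 )+\sum_{t-j\leq m\leq t}\chi_{sm}\Big)\\ &+(q-1)\Big(\mathscr{R}\sum_{t-j\leq m\leq t}\chi_{s-i-1,m}+\mathscr{N}\sum_{t-j\leq m\leq t}\chi_{s-i-1,m}^*\Big)\\ &-\big(\mathscr{R}\chi_{s-i-1,t-j-1}+\mathscr{N}\chi_{s-i-1,t-j-1}^*\big)\\ &-\frac{p-1}{2}\big(\chi_{s-i,t-j-1}+\chi_{s-i,t-j-1}^*\big)\Big). \end{aligned}\] (iv) For $1\leq i\leq s-1$ and $j=t$, \[\begin{aligned} \theta_{it}=\frac{1}{p^{i+1}q^t}\Big(&\frac{p-1}{2}\sum_{\substack{s-i\leq k\leq s-1\\ 0\leq m\leq t}}(\chi_{km}+\chi_{km}^* )+\frac{p-1}{2}\sum_{0\leq m\leq t}\chi_{sm}\\&+\mathscr{N}\sum_{0\leq m\leq t}\chi_{s-i-1,m}+\mathscr{R}\sum_{0\leq m\leq t}\chi_{s-i-1,m}^*\Big), \end{aligned}\] \[\begin{aligned} \theta_{it}^*=\frac{1}{p^{i+1}q^t}\Big(&\frac{p-1}{2}\sum_{\substack{s-i\leq k\leq s-1\\ 0\leq m\leq t}}(\chi_{km}+\chi_{km}^* )+\frac{p-1}{2}\sum_{0\leq m\leq t}\chi_{sm}\\&+\mathscr{R}\sum_{0\leq m\leq t}\chi_{s-i-1,m}+\mathscr{N}\sum_{0\leq m\leq t}\chi_{s-i-1,m}^*\Big). \end{aligned}\] (v) For $i=s$ and $0\leq j\leq t-1$, \[\begin{aligned} \theta_{sj}=\frac{1}{p^sq^{j+1}}\Big(&(q-1)\Big(\sum_{\substack{0\leq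 k\leq s-1\\t-j\leq m\leq t}}(\chi_{km}+\chi_{km}^* )+\sum_{t-j\leq m\leq t}\chi_{sm}\Big)\\ &-\Big(\sum_{0\leq k\leq s-1}(\chi_{k,t-j-1}+\chi_{k,t-j-1}^* )+\chi_{s,t-j-1}\Big)\Big). \end{aligned}\] (vi) For $i=s$ and $j=t$, \[\theta_{st}=\frac{1}{p^sq^t}\Big(\sum_{\substack{0\leq k\leq s-1\\0\leq m\leq t}}(\chi_{km}+\chi_{km}^* )+\sum_{0\leq m\leq t}\chi_{sm}\Big)=\frac{1}{p^sq^t}\sum_{0\leq u< p^sq^t}x^u.\]
   Context: Here $\phi$ is Euler's phi function (with $\phi(1)=1$) and $\mathrm{ord}_m(k)$ is the multiplicative order of $k$ modulo $m$. Put $n=p^sq^t$. Fix an integer $g$ that is a primitive root both modulo $p^s$ and modulo $q^t$. For an integer $\gamma$, $C_\gamma=\{\gamma l^r \bmod n: r\geq 0\}\subseteq \mathbb{Z}_n$ is the $l$-cyclotomic coset modulo $n$ containing $\gamma$. For $0\leq i\leq s$, $0\leq j\leq t$ set $C_{ij}=C_{p^iq^j}$ and $C_{ij}^*=C_{p^iq^jg}$; in particular $C_{sj}=C_{sj}^*$ and $C_{st}=C_0=\{0\}$. Define elements of $\mathbb{F}_l[x]/\langle x^{n}-1\rangle$ by $\chi_{ij}=\sum_{a\in C_{ij}}x^a$ and $\chi_{ij}^*=\sum_{a\in C_{ij}^*}x^a$; in particular $\chi_{sj}=\chi_{sj}^*$ and $\chi_{st}=1$. Let $\alpha$ be a fixed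 primitive $n$-th root of unity in some extension field of $\mathbb{F}_l$. For an integer $\gamma$ let $M_\gamma(x)=\prod_{u\in C_\gamma}(x-\alpha^u)$, the minimal polynomial of $\alpha^\gamma$ over $\mathbb{F}_l$, and let $\theta_\gamma(x)$ be the primitive idempotent of the minimal ideal of $\mathbb{F}_l[x]/\langle x^n-1\rangle$ generated by $(x^n-1)/M_\gamma(x)$; that is, $\theta_\gamma(\alpha^u)=1$ if $u\in C_\gamma$ and $\theta_\gamma(\alpha^u)=0$ if $u\notin C_\gamma$. Set $\theta_{ij}=\theta_{p^iq^j}$ and $\theta_{ij}^*=\theta_{p^iq^jg}$; in particular $\theta_{sj}=\theta_{sj}^*$ and $\theta_{st}=\theta_0$. Let $\beta=\alpha^{p^{s-1}q^t}$, a primitive $p$-th root of unity, let $R_1$ and $N_1$ be the sets of quadratic residues and quadratic nonresidues in $\mathbb{Z}_p^*$, and put $\mathscr{R}=\sum_{x\in R_1}\beta^x$ and $\mathscr{N}=\sum_{x\in N_1}\beta^x$. These are elements of $\mathbb{F}_l$, the two roots of $x^2+x+\frac{p+1}{4}=0$: for $l=2$ one takes, without loss of generality, $\mathscr{R}=1$ and $\mathscr{N}=0$, and for $l$ odd $\mathscr{R}=\frac{-1+\delta}{2}$, $\mathscr{N}=\frac{-1-\delta}{2}$ for some $\delta\in\mathbb{F}_l$ with $\delta^2=-p$. Integers and their inverses appearing as coefficients are read in $\mathbb{F}_l$.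
   Formalization: In both formulas of (iii), as printed false (e.g. p=7, q=11, l=2, s=2, t=1, i=1, j=0), the last line is corrected to −(p−1)/2·(Σ_{s−i≤k≤s−1}(χ_{k,t−j−1}+χ*_{k,t−j−1})+χ_{s,t−j−1}). *)

(* Defs.v *)
From mathcomp Require Import all_boot all_order all_algebra.

Set Implicit Arguments.
Unset Strict Implicit.
Unset Printing Implicit Defensive.

Import GRing.Theory.
Local Open Scope ring_scope.

(* [d] is the multiplicative order of [k] modulo [m]; only meaningful for
   [1 < m], because ['Z_0] and ['Z_1] are both the ring of integers mod 2.
   [d.-primitive_root z] says that [d] is the least positive exponent with
   [z ^+ d = 1]; in particular [k] is then invertible mod [m]. *)
Definition is_mult_order (m : nat) (k : int) (d : nat) : bool :=
  d.-primitive_root (k%:~R : 'Z_m).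

Definition is_primitive_root_mod (m : nat) (g : int) : bool :=
  is_mult_order m g (totient m).

Definition quad_res (p : nat) : {set 'F_p} :=
  [set x | (x != 0) && [exists y, y ^+ 2 == x]].

Definition quad_nonres (p : nat) : {set 'F_p} :=
  [set x | (x != 0) && ~~ [exists y, y ^+ 2 == x]].

(* Exponents [r < n] already give the whole coset, see [mem_ccoset]. *)
Definition ccoset (n l : nat) (gamma : int) : {set 'I_n} :=
  [set a : 'I_n |
    [exists r : 'I_n, (a%:Z == gamma * l%:Z ^+ r %[mod n%:Z])%Z]].

Lemma mem_ccoset (n l : nat) (gamma : int) (a : 'I_n) :
  reflect (exists r : nat, (a%:Z = gamma * l%:Z ^+ r %[mod n%:Z])%Z)
          (a \in ccoset n l gamma).
Proof.
rewrite inE; apply: (iffP existsP) => [[r /eqP e]|[r e]]; first by exists r.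
have n_gt0 : (0 < n)%N := leq_ltn_trans (leq0n a) (ltn_ord a).
have nz : n%:Z != 0 by rewrite eqz_nat -lt0n.
pose f (x : 'I_n) := Ordinal (ltn_pmod (x * l) n_gt0).
have x0P : (`|(gamma %% n%:Z)%Z|%N < n)%N.
  by rewrite -ltz_nat gez0_abs ?modz_ge0 // ltz_pmod.
pose x0 := Ordinal x0P.
have itE k : ((iter k f x0)%:Z = (gamma * l%:Z ^+ k)%R %% n%:Z)%Z.
  elim: k => [|k IH]; first by rewrite /= gez0_abs ?modz_ge0 // expr0 mulr1.
  by rewrite iterS /= -modz_nat PoszM IH modzMml exprSr mulrA.
have ar : a = iter r f x0.
  apply/val_inj; apply/eqP; rewrite -eqz_nat itE -e modz_small //.
  by rewrite lez_nat ltz_nat ltn_ord.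
have c : fconnect f x0 a by rewrite ar fconnect_iter.
have lt : (findex f x0 a < n)%N.
  apply: leq_trans (findex_max c) _.
  by rewrite -[X in (_ <= X)%N](card_ord n) max_card.
exists (Ordinal lt); apply/eqP => /=.
by rewrite -[in LHS](iter_findex c) itE modz_mod.
Qed.

(* [{poly %/ h}] is the quotient by [h] when [h] is monic of positive degree,
   which holds here as soon as [0 < n]. *)
Notation cyclic_alg n l := {poly %/ ('X^n - 1 : {poly 'F_l})}.

Definition chi (n l : nat) (gamma : int) : cyclic_alg n l :=
  in_qpoly _ (\sum_(a in ccoset n l gamma) 'X^a).

Definition primitive_idempotent (A : comNzRingType) (e : A) : Prop :=
  [/\ e != 0, e * e = e &
      forall f h : A, f * f = f -> h * h = h -> f * h = 0 -> e = f + h ->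
        f = 0 \/ h = 0].

Definition same_principal_ideal (A : comNzRingType) (a b : A) : Prop :=
  forall x : A, (exists c, x = c * a) <-> (exists c, x = c * b).

(* [M] is unique, [map_poly iota] being injective; an ideal of a commutative
   ring has at most one idempotent generator, so [e] is unique too, see
   [is_theta_uniq]. *)
Definition is_theta (n l : nat) (L : fieldType) (iota : {rmorphism 'F_l -> L})
    (alpha : L) (gamma : int) (e : cyclic_alg n l) : Prop :=
  exists M : {poly 'F_l},
    [/\ map_poly iota M =
          \prod_(u in ccoset n l gamma) ('X - (alpha ^+ u)%:P),
        primitive_idempotent e &
        same_principal_ideal e (in_qpoly _ (('X^n - 1) %/ M))].

Lemma is_theta_uniq (n l : nat) (L : fieldType)
    (iota : {rmorphism 'F_l -> L}) (alpha : L) (gamma : int)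
    (e f : cyclic_alg n l) :
  is_theta iota alpha gamma e -> is_theta iota alpha gamma f -> e = f.
Proof.
case=> M [hM [_ ee _] eI] [M' [hM' [_ ff _] fI]].
have MM : M = M' by apply: (@map_poly_inj _ _ iota); rewrite hM hM'.
rewrite -{}MM in fI.
have [a ea] : exists c, e = c * f.
  by apply/fI/eI; exists 1; rewrite mul1r.
have [b fb] : exists c, f = c * e.
  by apply/eI/fI; exists 1; rewrite mul1r.
have e_ef : e = e * f by rewrite {2}ea -mulrA ff -ea.
by rewrite e_ef mulrC {1}fb -mulrA ee -fb.
Qed.

(* Main.v *)
(* The coefficient of [x^a] in [theta_gamma] is [n^-1] times the sum of
   [alpha^(-a u)] over the coset [C_gamma].  Let [h = (p - 1) / 2]; it is odd.
   The orders of [l] modulo [p^s] and [q^t] being coprime, [l] generates modulo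
   [n] all the units [w] with [w^h = 1] modulo [p]; since [q^h = 1] as well,
   [C_ij] and [C_ij^*], for [i < s], are the sets of [a] with valuations [i] at
   [p] and [j] at [q] (capped by [s] and [t]) for which [(a / p^i)^h] is [1],
   resp. [-1].  The union [D_ij] of the [C_ij'] with [j <= j'] is then described
   by one divisibility and one quadratic condition, and writing
   [u = p^i q^j (w0 + p w1)] splits the sum of [alpha^(-a u)] over [D_ij] into a
   geometric sum and a quadratic Gaussian period.  The formulas follow since
   [C_ij] is [D_ij] minus [D_i(j+1)]. *)
Require Import Defs.
From mathcomp Require Import all_boot all_order all_fingroup all_algebra.
From mathcomp Require Import all_solvable all_field.
From mathcomp Require Import zify ring.

Set Implicit Arguments.
Unset Strict Implicit.
Unset Printing Implicit Defensive.

Import Order.TTheory GRing.Theory Num.Theory.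
Local Open Scope ring_scope.

(** The sums of powers of [alpha] exist only in [L], so the computation takes place there. A
    primitive n-th root of unity forces n to be nonzero in [L], hence evaluation at the powers of
    [alpha] can be inverted, and injectivity of [iota] brings the coefficients back to 'F_l. The
    unions D_ij replace the cosets because the condition that the valuation at q is exactly j is not
    periodic modulo p; on D_ij only the quadratic condition modulo p remains, and this is what lets
    the sum factor. Since p = 3 mod 4, -1 is a nonresidue: the sign in alpha^(-a u) exchanges the
    two periods, which is why N goes with the unstarred sums in theta_ij, and R with the starred
    ones. *)

Lemma Posz_expn (m k : nat) : (m ^ k)%N%:Z = m%:Z ^+ k.
Proof. by rewrite -[LHS]natz natrX natz. Qed.

Lemma sum_unity_root_expr (F : fieldType) (n : nat) (z : F) :
  z ^+ n = 1 -> \sum_(a < n) z ^+ a = (if z == 1 then n%:R else 0).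
Proof.
move=> zn; case: eqP => [->|/eqP z1].
  rewrite (eq_bigr (fun=> 1)) ?sumr_const ?card_ord // => i _.
  by rewrite expr1n.
have /esym/eqP := subrX1 z n.
by rewrite zn subrr mulf_eq0 subr_eq0 (negPf z1) => /eqP.
Qed.

(** * Descent from L to the prime field by the l-power map *)

Lemma rmorph_Fp_frobenius (l : nat) (L : fieldType)
    (iota : {rmorphism 'F_l -> L}) (c : 'F_l) :
  prime l -> iota c ^+ l = iota c.
Proof.
by move=> l_pr; have := expf_card c; rewrite card_Fp // -rmorphXn => ->.
Qed.

Lemma Fp_frobenius_fixed (l : nat) (L : fieldType)
    (iota : {rmorphism 'F_l -> L}) (y : L) :
  prime l -> y ^+ l = y -> {c | iota c = y}.
Proof.
move=> l_pr yl; case: (pickP (fun c => iota c == y)) => [c /eqP|nc].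
  by exists c.
(* X^l - X is the product of all X - c with c in 'F_l; at its root y one of these factors must
   vanish. *)
exfalso; have := finField_genPoly 'F_l.
move=> /(congr1 (fun P => (map_poly iota P).[y])).
rewrite card_Fp // rmorphB rmorph_prod /= map_polyXn map_polyX.
rewrite !hornerE yl subrr horner_prod => /esym/eqP/prodf_eq0 [c _].
rewrite rmorphB /= map_polyX map_polyC !hornerE subr_eq0 => /eqP yc.
by have := nc c; rewrite yc eqxx.
Qed.

Lemma map_poly_Fp_descent (l : nat) (L : fieldType)
    (iota : {rmorphism 'F_l -> L}) (P : {poly L}) :
  prime l -> (forall i, P`_i ^+ l = P`_i) -> {M | map_poly iota M = P}.
Proof.
move=> l_pr Pl.
exists (\poly_(i < size P) sval (Fp_frobenius_fixed iota l_pr (Pl i))).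
apply/polyP => i; rewrite coef_map coef_poly /=; case: ltnP => iP.
  by case: Fp_frobenius_fixed.
by rewrite rmorph0 nth_default.
Qed.

(** * Primitive idempotents of cyclic algebras *)

Section CyclicAlgebra.

Variables n l : nat.
Hypothesis n_gt0 : (0 < n)%N.
Local Notation A := (cyclic_alg n l).
Implicit Types (x y : A) (c : 'F_l) (a : nat).

Lemma mk_monic_XnsubC : mk_monic ('X^n - 1 : {poly 'F_l}) = 'X^n - 1.
Proof. by rewrite /mk_monic size_XnsubC // ltnS n_gt0 monicXnsubC. Qed.

Lemma size_cyclic_alg x : (size (x : {poly 'F_l}) <= n)%N.
Proof.
have := size_mk_monic x; move: (polyn x) => P.
by rewrite mk_monic_XnsubC size_XnsubC.
Qed.

Lemma in_cyclic_alg_small (P : {poly 'F_l}) :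
  (size P <= n)%N -> in_qpoly ('X^n - 1) P = P :> {poly 'F_l}.
Proof.
by move=> sP; rewrite in_qpoly_small // mk_monic_XnsubC size_XnsubC.
Qed.

(** Naming the coefficient lets identities of the quotient algebra be rewritten coefficientwise, and
    so be left to [ring] in 'F_l. *)
Definition qcoef a x : 'F_l := (x : {poly 'F_l})`_a.

Lemma qcoefD a x y : qcoef a (x + y) = qcoef a x + qcoef a y.
Proof. exact: coefD. Qed.

Lemma qcoefB a x y : qcoef a (x - y) = qcoef a x - qcoef a y.
Proof. exact: coefB. Qed.

Lemma qcoefZ a c x : qcoef a (c *: x) = c * qcoef a x.
Proof. exact: coefZ. Qed.

Lemma qcoef_sum a (r : seq nat) (F : nat -> A) :
  qcoef a (\sum_(i <- r) F i) = \sum_(i <- r) qcoef a (F i).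
Proof. exact: coefn_sum. Qed.

Lemma qcoefP x y : (forall a, (a < n)%N -> qcoef a x = qcoef a y) -> x = y.
Proof.
move=> exy; apply/npolyP => a; case: (ltnP a n) => an; first exact: exy.
by rewrite !nth_default // (leq_trans (size_cyclic_alg _)).
Qed.

Lemma qcoef_chi (gamma : int) a (an : (a < n)%N) :
  qcoef a (chi n l gamma) = (Ordinal an \in ccoset n l gamma)%:R.
Proof.
rewrite /qcoef /chi in_cyclic_alg_small.
  rewrite coef_sum; under eq_bigr do rewrite coefXn.
  rewrite big_mkcond (bigD1 (Ordinal an)) //= big1 ?addr0.
    by rewrite eqxx; case: ifP.
  by move=> b ba; rewrite eq_sym (negPf ba : (b == a :> nat) = false) if_same.
apply: (leq_trans (size_sum _ _ _)); apply/bigmax_leqP => b _.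
by rewrite size_polyXn.
Qed.

End CyclicAlgebra.

(** * Evaluation at powers of a root of unity, and Fourier inversion *)

Section CyclicCosets.

Variables (n l : nat) (L : fieldType).
Variables (iota : {rmorphism 'F_l -> L}) (alpha : L).
Hypotheses (l_pr : prime l) (alpha_prim : n.-primitive_root alpha).

Local Notation A := (cyclic_alg n l).
Implicit Types (x y e f h : A) (gamma : int) (u a b : nat).

Let n_gt0 : (0 < n)%N := prim_order_gt0 alpha_prim.

Definition root_eval x u : L := (map_poly iota x).[alpha ^+ u].

Lemma root_eval_in_qpoly (P : {poly 'F_l}) u :
  root_eval (in_qpoly ('X^n - 1) P) u = (map_poly iota P).[alpha ^+ u].
Proof.
rewrite /root_eval /= mk_monic_XnsubC //.
rewrite [in RHS](Pdiv.RingMonic.rdivp_eq (monicXnsubC 1 n_gt0) P).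
rewrite !(rmorphD, rmorphM, rmorphN, rmorph1) /= map_polyXn !hornerE.
by rewrite exprAC (prim_expr_order alpha_prim) expr1n subrr mulr0 add0r.
Qed.

Lemma root_evalM x y u : root_eval (x * y) u = root_eval x u * root_eval y u.
Proof. by rewrite root_eval_in_qpoly rmorphM hornerM. Qed.

Lemma root_eval0 u : root_eval 0 u = 0.
Proof. by rewrite /root_eval rmorph0 horner0. Qed.

Lemma root_evalE x u :
  root_eval x u = \sum_(a < n) iota (qcoef a x) * alpha ^+ (a * u).
Proof.
rewrite /root_eval (@horner_coef_wide _ n) ?size_map_poly ?size_cyclic_alg //.
by apply: eq_bigr => a _; rewrite coef_map mulnC exprM.
Qed.

Lemma root_orthogonality u v :
  (u < n)%N -> (v < n)%N ->
  \sum_(a < n) alpha ^+ (a * u) * alpha ^- (a * v) = (n%:R *+ (u == v) : L).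
Proof.
move=> un vn; have a_nz : alpha != 0.
  by rewrite (prim_root_eq0 alpha_prim) -lt0n.
have zn : (alpha ^+ u * alpha ^- v) ^+ n = 1.
  by rewrite exprMn exprVn -!exprM !(mulnC _ n) !exprM
             (prim_expr_order alpha_prim)
             !expr1n invr1 mulr1.
rewrite -[u == v](congr2 eq_op (modn_small un) (modn_small vn)).
rewrite -(eq_prim_root_expr alpha_prim).
transitivity (\sum_(a < n) (alpha ^+ u * alpha ^- v) ^+ a).
  by apply: eq_bigr => a _; rewrite exprMn exprVn -!exprM !(mulnC a).
rewrite sum_unity_root_expr //.
have -> : (alpha ^+ u / alpha ^+ v == 1) = (alpha ^+ u == alpha ^+ v).
  by apply/eqP/eqP => [/divr1_eq //|->]; rewrite divff // expf_neq0.
by case: eqP.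
Qed.

Lemma root_eval_inv x a : (a < n)%N ->
  \sum_(u < n) root_eval x u * alpha ^- (a * u)
    = n%:R * iota (qcoef a x).
Proof.
move=> an; under eq_bigr do rewrite root_evalE mulr_suml.
rewrite exchange_big /= (bigD1 (Ordinal an)) //= [X in _ + X]big1 ?addr0.
  under eq_bigr do rewrite -mulrA (mulnC a).
  by rewrite -mulr_sumr root_orthogonality // eqxx mulrC.
move=> b ba; under eq_bigr do rewrite -mulrA (mulnC a) (mulnC b).
rewrite -mulr_sumr root_orthogonality //.
by rewrite (negPf ba : (b == a :> nat) = false) mulr0.
Qed.

Lemma root_eval_inj x y :
  (forall u, (u < n)%N -> root_eval x u = root_eval y u) -> x = y.
Proof.
move=> exy; apply: (qcoefP n_gt0) => a an; apply: (fmorph_inj iota).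
apply: (mulfI (prim_root_natf_neq0 alpha_prim)).
by rewrite -!root_eval_inv //; apply: eq_bigr => u _; rewrite exy.
Qed.

(** The l-power map is a ring endomorphism of [L] that fixes the coefficients, so evaluation
    commutes with it. The values along a cyclotomic coset are therefore powers of a single one. *)
Lemma root_eval_frobenius x c r :
  (map_poly iota x).[alpha ^+ c ^+ (l ^ r)] = root_eval x c ^+ (l ^ r).
Proof.
have lL : l \in [pchar L] by rewrite (rmorph_pchar iota) // pchar_Fp.
have lfix (z : L) : ((map_poly iota x).[z]) ^+ l = (map_poly iota x).[z ^+ l].
  rewrite -(pFrobenius_autE lL) -horner_map /= -map_poly_comp.
  congr (_.[_]); apply: eq_map_poly => b /=.
  by rewrite pFrobenius_autE rmorph_Fp_frobenius.
elim: r => [|r IH]; first by rewrite expn0 !expr1.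
by rewrite expnSr !exprM -lfix IH.
Qed.


Let lL : l \in [pchar L].
Proof. by rewrite (rmorph_pchar iota) // pchar_Fp. Qed.

Let co_ln : coprime l n.
Proof.
rewrite prime_coprime //; apply/negP => ln.
by have := prim_root_pcharF alpha_prim ln; rewrite lL.
Qed.

Let shift (u : 'I_n) : 'I_n := Ordinal (ltn_pmod (u * l) n_gt0).

Let shift_inj : injective shift.
Proof.
move=> u v /(congr1 val) /= /eqP.
rewrite -(eq_prim_root_expr alpha_prim) !(mulnC _ l) !exprM.
have al_prim : n.-primitive_root (alpha ^+ l).
  by rewrite (prim_root_exp_coprime _ alpha_prim).
rewrite (eq_prim_root_expr al_prim) !modn_small ?ltn_ord // => /eqP.
exact: val_inj.
Qed.

Lemma mem_ccoset_mull gamma (u : 'I_n) :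
  (shift u \in ccoset n l gamma) = (u \in ccoset n l gamma).
Proof.
set C := ccoset n l gamma.
(* An injection of the finite set C into itself is onto, which gives both directions of the
   equivalence at once. *)
suff sC : shift @: C = C by rewrite -{1}sC mem_imset.
apply/eqP; rewrite eqEcard card_imset // leqnn andbT.
apply/subsetP => _ /imsetP [v /mem_ccoset [r vr] ->].
apply/mem_ccoset; exists r.+1.
by rewrite /= -modz_nat PoszM -modzMml vr modzMml modz_mod exprSr mulrA.
Qed.

(** [gamma] may be negative; its residue modulo n is a natural base point from which Frobenius
    powers reach the whole coset. *)
Lemma ccoset_base gamma : exists u0 : 'I_n, u0 \in ccoset n l gamma /\
  forall u : 'I_n, u \in ccoset n l gamma ->
    exists r, alpha ^+ u = alpha ^+ u0 ^+ (l ^ r).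
Proof.
have nz : n%:Z != 0 by rewrite eqz_nat -lt0n.
have u0P : (`|(gamma %% n%:Z)%Z|%N < n)%N.
  by rewrite -ltz_nat gez0_abs ?modz_ge0 // ltz_pmod.
exists (Ordinal u0P); split.
  apply/mem_ccoset; exists 0%N.
  by rewrite /= gez0_abs ?modz_ge0 // modz_mod expr0 mulr1.
move=> u /mem_ccoset [r ur]; exists r; apply/eqP.
rewrite -exprM (eq_prim_root_expr alpha_prim) -eqz_nat -!modz_nat ur /=.
by rewrite PoszM gez0_abs ?modz_ge0 // modzMml Posz_expn.
Qed.

Definition coset_poly gamma : {poly L} :=
  \prod_(u in ccoset n l gamma) ('X - (alpha ^+ u)%:P).

(** The l-power map permutes the roots of the product, hence fixes its coefficients. *)
Lemma coset_poly_descent gamma :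
  {M : {poly 'F_l} | map_poly iota M = coset_poly gamma}.
Proof.
apply: map_poly_Fp_descent => // i.
suff fixP : map_poly (pFrobenius_aut lL) (coset_poly gamma) = coset_poly gamma.
  by rewrite -[in RHS]fixP coef_map /= pFrobenius_autE.
rewrite /coset_poly rmorph_prod [RHS](reindex_inj shift_inj) /=.
apply: eq_big => [u|u _]; first by rewrite mem_ccoset_mull.
rewrite rmorphB /= map_polyX map_polyC /= pFrobenius_autE -exprM.
by rewrite -[in LHS](prim_expr_mod alpha_prim).
Qed.

Lemma coset_cofactor_root_eval gamma (M : {poly 'F_l}) (u : 'I_n) :
  map_poly iota M = coset_poly gamma ->
  (root_eval (in_qpoly ('X^n - 1) (('X^n - 1) %/ M)) u == 0)
    = (u \notin ccoset n l gamma).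
Proof.
move=> hM; have M_nz : coset_poly gamma != 0.
  by apply/prodf_neq0 => v _; rewrite polyXsubC_eq0.
rewrite root_eval_in_qpoly map_divp hM.
(* X^n - 1 is the product of X - alpha^u over all u < n; dividing by the coset factors leaves the
   product over the complement. *)
rewrite !(rmorphB, rmorph1) /= map_polyXn -(factor_Xn_sub_1 alpha_prim).
rewrite big_mkord (bigID (mem (ccoset n l gamma))) /= mulKp //.
rewrite horner_prod; apply/prodf_eq0/idP => [[v vC]|uC]; last first.
  by exists u; rewrite // !hornerE subrr.
rewrite !hornerE subr_eq0 (eq_prim_root_expr alpha_prim) !modn_small //.
by move/eqP/val_inj->.
Qed.

(* The cofactor [K] takes its values in a field where [x^(l^totient n) = x], so
   this power of [K] is 1 where [K] does not vanish. *)
Lemma coset_idempotent gamma (M : {poly 'F_l}) :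
  map_poly iota M = coset_poly gamma ->
  let K : A := in_qpoly ('X^n - 1) (('X^n - 1) %/ M) in
  let e := K ^+ (l ^ totient n).-1 in
  [/\ forall u : 'I_n, root_eval e u = (u \in ccoset n l gamma)%:R,
      primitive_idempotent e & same_principal_ideal e K].
Proof.
move=> hM K e.
have evX x k u : root_eval (x ^+ k) u = root_eval x u ^+ k.
  elim: k => [|k IH]; last by rewrite !exprS root_evalM IH.
  rewrite !expr0 -(in_qpoly1 ('X^n - 1 : {poly 'F_l})) root_eval_in_qpoly.
  by rewrite rmorph1 hornerC.
have tot_gt0 : (0 < totient n)%N by rewrite totient_gt0.
have exp_gt0 : (0 < (l ^ totient n).-1)%N.
  by rewrite -ltnS prednK ?expn_gt0 ?prime_gt0 // -[1%N](expn0 l)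
             ltn_exp2l ?prime_gt1.
have ev_e (u : 'I_n) : root_eval e u = (u \in ccoset n l gamma)%:R.
  rewrite /e evX; have := coset_cofactor_root_eval u hM; rewrite -/K.
  case: eqP => [-> /esym /negPf -> | /eqP K_nz /esym /negbFE ->].
    by rewrite expr0n gtn_eqF.
  apply: (mulfI K_nz); rewrite mulr1 -exprS prednK ?expn_gt0 ?prime_gt0 //.
  rewrite -root_eval_frobenius -exprM; congr (_.[_]); apply/eqP.
  rewrite (eq_prim_root_expr alpha_prim) -modnMmr Euler_exp_totient //.
  by rewrite modnMmr muln1.
have e_idem : e * e = e.
  apply: root_eval_inj => u un; rewrite root_evalM (ev_e (Ordinal un)).
  by case: (_ \in _); rewrite ?mulr1 ?mulr0.
split=> //.
  split=> //.
    have [u0 [u0C _]] := ccoset_base gamma; apply/eqP => e0.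
    have := ev_e u0; rewrite e0 u0C root_eval0 => /eqP.
    by rewrite eq_sym oner_eq0.
  (* The values of the idempotents f and h are 0 or 1, hence Frobenius-invariant and constant on the
     coset. As f h = 0, one of the two vanishes on the coset; it vanishes off the coset too, being a
     multiple of e. *)
  move=> f h ff hh fh ed.
  have [u0 [u0C u0r]] := ccoset_base gamma.
  have idem01 x : x * x = x -> forall u, root_eval x u = 0 \/ root_eval x u = 1.
    move=> xx u; have /eqP := root_evalM x x u.
    rewrite xx -subr_eq0 -{1}[root_eval x u]mulr1 -mulrBr mulf_eq0 subr_eq0.
    by case/orP => /eqP; [left|right].
  have const x : x * x = x -> forall u : 'I_n, u \in ccoset n l gamma ->
      root_eval x u = root_eval x u0.
    move=> xx u /u0r [r ur]; rewrite {1}/root_eval ur root_eval_frobenius.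
    case: (idem01 x xx u0) => ->; rewrite ?expr1n //.
    by rewrite expr0n gtn_eqF ?expn_gt0 ?prime_gt0.
  have zero x : x * x = x -> x * e = x -> root_eval x u0 = 0 -> x = 0.
    move=> xx xe x0; apply: root_eval_inj => u un.
    rewrite root_eval0 -xe root_evalM (ev_e (Ordinal un)).
    have [uC|] := boolP (_ \in _); last by rewrite mulr0.
    by rewrite -[u]/(val (Ordinal un)) const // x0 mul0r.
  have fe : f * e = f by rewrite ed mulrDr ff fh addr0.
  have he : h * e = h by rewrite ed mulrDr hh mulrC fh add0r.
  have /eqP := root_evalM f h u0; rewrite fh root_eval0 eq_sym mulf_eq0.
  by case/orP => /eqP ?; [left|right]; apply: zero.
move=> x; split=> [[c ->]|[c ->]].
  by exists (c * K ^+ (l ^ totient n).-2); rewrite -mulrA -exprSr prednK.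
(* K = K e, because e takes the value 1 wherever K does not vanish. *)
exists (c * K); rewrite -mulrA; congr (_ * _).
apply: root_eval_inj => u un; rewrite root_evalM (ev_e (Ordinal un)).
have := coset_cofactor_root_eval (Ordinal un) hM; rewrite -/K /=.
by case: (_ \in _) => /=; [rewrite mulr1 | move/eqP->; rewrite mul0r].
Qed.

(** Fourier inversion applied to the values 0 and 1 of the idempotent. The sigma type allows [theta]
    to be defined as a function of [gamma]. *)
Lemma ccoset_thetaP gamma :
  {e : A | is_theta iota alpha gamma e /\
     forall a, (a < n)%N -> n%:R * iota (qcoef a e)
       = \sum_(u in ccoset n l gamma) alpha ^- (a * u)}.
Proof.
have [M hM] := coset_poly_descent gamma.
have [ev_e e_prim e_ideal] := coset_idempotent hM.
set e := _ ^+ _ in ev_e e_prim e_ideal.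
exists e; split; first by exists M.
move=> a an; rewrite -root_eval_inv // [RHS]big_mkcond.
by apply: eq_bigr => u _; rewrite ev_e; case: ifP; rewrite ?mul1r ?mul0r.
Qed.

End CyclicCosets.

Lemma eq_Zp_nat (N a b : nat) :
  (1 < N)%N -> (a%:R == b%:R :> 'Z_N) = (a == b %[mod N]).
Proof. by move=> N_gt1; rewrite -val_eqE /= !val_Zp_nat. Qed.

Lemma eq_Fp_nat (p a b : nat) :
  prime p -> (a%:R == b%:R :> 'F_p) = (a == b %[mod p]).
Proof. by move=> p_pr; rewrite -val_eqE /= !val_Fp_nat. Qed.

(** Pure counting: it turns the hypotheses on the order of l into statements that its powers, up to
    sign modulo p^s, are all the units. *)
Lemma unit_Zp_exhaust (N : nat) (T : finType) (f : T -> 'Z_N) :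
  (1 < N)%N -> injective f -> (forall x, f x \is a GRing.unit) ->
  #|T| = totient N ->
  forall y, y \is a GRing.unit -> exists x, f x = y.
Proof.
move=> N_gt1 f_inj f_unit cardT y y_unit.
pose f' x : {unit 'Z_N} := FinRing.unit _ (f_unit x).
have f'_inj : injective f' by move=> u v /(congr1 val) /= /f_inj.
have card' : (#|{: {unit 'Z_N}}| <= #|T|)%N.
  by rewrite cardT -card_units_Zp ?(ltnW N_gt1) // cardsT.
have /codomP [x /(congr1 val) /= yx] :=
  inj_card_onto f'_inj card' (FinRing.unit _ y_unit).
by exists x.
Qed.

(** * The quadratic character modulo p *)

Section QuadraticCharacter.

Variable p : nat.
Hypotheses (p_pr : prime p) (p34 : (p = 3 %[mod 4])%N).

Local Notation h := (p.-1 %/ 2)%N.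

Lemma half_pred_3mod4 : [/\ odd h, (h * 2 = p.-1)%N & (2 < p)%N].
Proof. by have := prime_gt1 p_pr; split; move: p34; lia. Qed.

Let h_odd : odd h. Proof. by case: half_pred_3mod4. Qed.
Let h2 : (h * 2 = p.-1)%N. Proof. by case: half_pred_3mod4. Qed.
Let p_gt2 : (2 < p)%N. Proof. by case: half_pred_3mod4. Qed.
Let h_gt0 : (0 < h)%N. Proof. by case: (h) h_odd. Qed.

Lemma Fp_sign_inj (e e' : bool) : ((-1) ^+ e == (-1) ^+ e' :> 'F_p) = (e == e').
Proof.
have N11 : (-1 == 1 :> 'F_p) = false.
  rewrite eq_sym -subr_eq0 opprK -[1 + 1](natrD _ 1 1).
  by rewrite -(dvdn_pcharf (pchar_Fp p_pr)) gtnNdvd.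
by case: e; case: e'; rewrite ?expr0 ?expr1 ?eqxx // 1?eq_sym N11.
Qed.

Lemma Fp_half_expr (x : 'F_p) : x != 0 -> exists e : bool, x ^+ h = (-1) ^+ e.
Proof.
move=> x_nz; have : (x ^+ h) ^+ 2 == 1.
  rewrite -exprM h2; apply/eqP/(mulfI x_nz).
  have := expf_card x; rewrite card_Fp // => xp.
  by rewrite mulr1 -exprS prednK ?prime_gt0.
by rewrite sqrf_eq1 => /orP [] /eqP ->; [exists false | exists true].
Qed.

Lemma half_expr_neq0 (x : 'F_p) (e : bool) : x ^+ h = (-1) ^+ e -> x != 0.
Proof.
by apply: contra_eqN => /eqP ->; rewrite expr0n gtn_eqF // eq_sym signr_eq0.
Qed.

Lemma mem_quad_res (x : 'F_p) : (x \in quad_res p) = (x ^+ h == 1).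
Proof.
rewrite inE; apply/andP/idP => [[x_nz /existsP [y /eqP yx]]|/eqP xh].
  have y_nz : y != 0 by apply: contra_neq x_nz => y0; rewrite -yx y0 expr0n.
  have [e ye] := Fp_half_expr y_nz.
  by rewrite -yx exprAC ye sqrr_sign.
split; first exact: (half_expr_neq0 (e := false)).
(* As h is odd, (h + 1) / 2 is an integer, and x^(h + 1) = x when x^h = 1: an explicit square
   root. *)
apply/existsP; exists (x ^+ h.+1./2).
have -> : (x ^+ h.+1./2) ^+ 2 = x ^+ h.+1.
  by rewrite -exprM; congr (_ ^+ _); move: h_odd; lia.
by rewrite exprS xh mulr1 eqxx.
Qed.

Lemma mem_quad_nonres (x : 'F_p) : (x \in quad_nonres p) = (x ^+ h == -1).
Proof.
have [->|x_nz] := eqVneq x 0.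
  by rewrite inE eqxx expr0n gtn_eqF //= eq_sym oppr_eq0 oner_eq0.
have := mem_quad_res x; rewrite !inE x_nz /= => ->.
have [e ->] := Fp_half_expr x_nz.
have := Fp_sign_inj e false; have := Fp_sign_inj e true.
by rewrite expr0 expr1 => -> ->; case: e.
Qed.

End QuadraticCharacter.

(** By Euler's criterion this is the Legendre symbol of w modulo p, as an element of 'F_p; as a
    power it is visibly multiplicative. *)
Definition half_char (p w : nat) : 'F_p := w%:R ^+ (p.-1 %/ 2).

Lemma half_charM p v w : half_char p (v * w) = half_char p v * half_char p w.
Proof. by rewrite /half_char natrM exprMn. Qed.

Lemma half_charX p w k : half_char p (w ^ k) = half_char p w ^+ k.
Proof. by rewrite /half_char natrX exprAC. Qed.

Lemma half_char_modn p v w : prime p -> (v = w %[mod p])%N ->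
  half_char p v = half_char p w.
Proof. by move=> p_pr /eqP; rewrite -eq_Fp_nat // /half_char => /eqP ->. Qed.

(** Here the quadratic residuosity of q acts: a factor q^j does not change the character, so the
    class condition does not depend on the column j. *)
Lemma half_char_quotient p q i j a : (0 < p)%N -> (0 < q)%N ->
  half_char p q = 1 -> (p ^ i * q ^ j %| a)%N ->
  half_char p (a %/ p ^ i) = half_char p (a %/ (p ^ i * q ^ j)).
Proof.
move=> p_gt0 q_gt0 char_q /dvdnP [w ->].
rewrite mulnK ?muln_gt0 ?expn_gt0 ?p_gt0 ?q_gt0 //.
rewrite [(p ^ i * _)%N]mulnC mulnA mulnK ?expn_gt0 ?p_gt0 //.
by rewrite half_charM half_charX char_q expr1n mulr1.
Qed.

Lemma mult_order_nat (N l d : nat) : is_mult_order N l d ->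
  d.-primitive_root (l%:R : 'Z_N).
Proof. by []. Qed.

Lemma mem_ccoset_nat (n l gamma : nat) (a : 'I_n) :
  reflect (exists r, (a = gamma * l ^ r %[mod n])%N) (a \in ccoset n l gamma).
Proof.
apply: (iffP (mem_ccoset _ _ _)) => -[r e]; exists r; apply/eqP.
  by rewrite -eqz_nat -!modz_nat e PoszM Posz_expn.
by move/eqP: e; rewrite -eqz_nat -!modz_nat PoszM Posz_expn.
Qed.

Lemma ccoset_mod (n l : nat) (gamma gamma' : int) :
  (gamma = gamma' %[mod n%:Z])%Z -> ccoset n l gamma = ccoset n l gamma'.
Proof.
by move=> e; apply/setP => a; apply/mem_ccoset/mem_ccoset => -[r ar]; exists r;
   rewrite ar -[LHS]modzMml -[RHS]modzMml e.
Qed.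

Lemma coprime_prim_root_Zp (N w d : nat) :
  (1 < N)%N -> d.-primitive_root (w%:R : 'Z_N) -> coprime N w.
Proof.
move=> N_gt1 w_prim; rewrite -unitZpE //; apply/unitrPr.
exists (w%:R ^+ d.-1); have d_gt0 := prim_order_gt0 w_prim.
by rewrite -exprS prednK // (prim_expr_order w_prim).
Qed.

(* [level_ind] and [class_ind] describe unions of cosets over all columns
   [>= j] (and all rows [>= i] for [level_ind]); they are empty for [j = t + 1],
   so that every column [j <= t] is a difference of two consecutive unions. *)
Definition level_ind (p q t i j a : nat) : bool :=
  (j <= t)%N && (p ^ i * q ^ j %| a)%N.

Definition class_ind (p q t : nat) (e : bool) (i j a : nat) : bool :=
  level_ind p q t i j a && (half_char p (a %/ p ^ i) == (-1) ^+ e).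

(** * Gaussian periods and character sums over cosets *)

(** In each of the N blocks of length g only the first index is a multiple of g. *)
Lemma sum_multiples (V : nmodType) (N g : nat) (P : pred nat) (F : nat -> V) :
  (0 < g)%N ->
  \sum_(0 <= u < N * g | (g %| u)%N && P u) F u
    = \sum_(0 <= w < N | P (g * w)%N) F (g * w)%N.
Proof.
move=> g_gt0; rewrite big_mkcond big_nat_mul [RHS]big_mkcond /=.
apply: eq_bigr => w _.
rewrite big_ltn ?ltn_pmul2r // dvdn_mull //= big_nat_cond big1 ?addr0.
  by rewrite mulnC.
move=> u; rewrite andbT => /andP [lo hi]; rewrite ifF //.
apply/negbTE/negP => /andP [/dvdnP [v uE] _].
by move: lo hi; rewrite uE !ltn_pmul2r // => lo; rewrite ltnS leqNgt lo.
Qed.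

(** Write the index as v p + w with w < p: the condition sees only w. *)
Lemma sum_residues (F : comNzRingType) (N p : nat) (P : pred nat) (z : F) :
  (forall w, P (w %% p)%N = P w) ->
  \sum_(0 <= w < N * p | P w) z ^+ w
    = (\sum_(w < N) (z ^+ p) ^+ w) * \sum_(0 <= w < p | P w) z ^+ w.
Proof.
move=> Pp; rewrite big_mkcond big_nat_mul big_mkord mulr_suml /=.
apply: eq_bigr => v _.
rewrite -[(v * p)%N]add0n big_addn mulSn addnK mulr_sumr [RHS]big_mkcond /=.
apply: eq_bigr => w _.
rewrite -Pp addnC modnMDl Pp; case: ifP => _; rewrite ?mulr0 //.
by rewrite exprD -exprM mulnC.
Qed.

Lemma sum_Fp (V : nmodType) (p : nat) (P : pred 'F_p) (F : nat -> V) :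
  prime p ->
  \sum_(0 <= w < p | P w%:R) F w = \sum_(x : 'F_p | P x) F x.
Proof.
move=> p_pr; rewrite -[X in index_iota 0 X](Fp_cast p_pr) big_mkord.
by apply: eq_bigl => x; rewrite natr_Zp.
Qed.

Section GaussianPeriods.

Variables (p : nat) (L : fieldType) (beta : L).
Hypotheses (p_pr : prime p) (p34 : (p = 3 %[mod 4])%N) (beta_p : beta ^+ p = 1).

Local Notation h := (p.-1 %/ 2)%N.

(** The two Gaussian periods: [period false] runs over the quadratic residues and [period true] over
    the nonresidues. *)
Definition period (e : bool) : L :=
  \sum_(x : 'F_p | x ^+ h == (-1) ^+ e) beta ^+ x.

(** As h is odd, negation exchanges the two classes, and together they fill the p - 1 nonzero
    elements. *)
Lemma card_half_class (e : bool) : #|[pred x : 'F_p | x ^+ h == (-1) ^+ e]| = h.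
Proof.
have [h_odd h2 _] := half_pred_3mod4 p_pr p34.
have cardN : #|[pred x : 'F_p | x ^+ h == (-1) ^+ true]|
           = #|[pred x : 'F_p | x ^+ h == (-1) ^+ false]|.
  rewrite -[LHS](card_imset _ (@oppr_inj 'F_p)) -[RHS]cardsE.
  congr #|pred_of_set _|.
  apply/setP => x; rewrite inE -[x in LHS]opprK mem_imset; last exact: oppr_inj.
  by rewrite !inE (exprNn x) -(signr_odd _ h) h_odd !expr1 mulN1r eqr_opp.
have := cardC (pred1 (0 : 'F_p)).
rewrite card_Fp // card1 => /(congr1 predn) /=.
have -> : #|predC (pred1 (0 : 'F_p))|
  = (#|[pred x : 'F_p | x ^+ h == (-1) ^+ false]| * 2)%N.
  rewrite muln2 -addnn -{2}cardN -cardUI.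
  have -> : #|[predI [pred x : 'F_p | x ^+ h == (-1) ^+ false]
              & [pred x : 'F_p | x ^+ h == (-1) ^+ true]]| = 0%N.
    apply: eq_card0 => x; rewrite !inE; apply/negbTE/negP => /andP [/eqP ->].
    by rewrite (Fp_sign_inj p_pr p34).
  rewrite addn0; apply: eq_card => x; rewrite !inE.
  apply/idP/orP => [/(Fp_half_expr p_pr p34) [[] ->]|].
  - by right.
  - by left.
  - by case=> /eqP /(half_expr_neq0 p_pr p34).
rewrite add0n => e2.
have {}e2 : #|[pred x : 'F_p | x ^+ h == (-1) ^+ false]| = h.
  by rewrite -[LHS](mulnK _ (isT : 0 < 2)%N) e2.
by case: e; rewrite ?cardN.
Qed.

(** If p divides b, every term is 1. Otherwise multiplication by b permutes 'F_p, preserving the two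
    classes when b is a residue and exchanging them when it is not. *)
Lemma sum_half_class (e : bool) b :
  \sum_(0 <= w < p | half_char p w == (-1) ^+ e) beta ^+ (b * w)
  = if (p %| b)%N then h%:R
    else period (if half_char p b == 1 then e else ~~ e).
Proof.
rewrite (sum_Fp (fun x => x ^+ h == (-1) ^+ e) (fun w => beta ^+ (b * w)) p_pr).
have [/dvdnP [c ->]|pb] := boolP (p %| b)%N.
  rewrite (eq_bigr (fun=> 1)) => [|x _].
    by rewrite sumr_const card_half_class.
  by rewrite mulnAC mulnC exprM beta_p expr1n.
have b_nz : b%:R != 0 :> 'F_p by rewrite -(dvdn_pcharf (pchar_Fp p_pr)).
rewrite /period [RHS](reindex_inj (mulfI b_nz)).
apply: eq_big => [x|x _].
  rewrite exprMn /half_char.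
  have [e' ->] := Fp_half_expr p_pr p34 b_nz.
  have -> : ((-1) ^+ e' == 1 :> 'F_p) = ~~ e'.
    by have := Fp_sign_inj p_pr p34 e' false; rewrite expr0 => ->; case: e'.
  rewrite -[RHS](inj_eq (mulrI (unitrX e' (unitrN1 _)))) mulrA -expr2.
  by rewrite sqrr_sign mul1r -signr_addb; case: e; case: e'.
have -> : (b%:R * x : 'F_p) = (b * x %% p)%N :> nat.
  by rewrite -val_Fp_nat // natrM natr_Zp.
by rewrite expr_mod.
Qed.

End GaussianPeriods.

(** * Indicators of unions of cosets, and their dual sums *)

Section Indicators.

Variables (p q t : nat).
Hypotheses (p_pr : prime p) (p34 : (p = 3 %[mod 4])%N).
Hypotheses (q_pr : prime q) (pq : p != q).

Local Notation h := (p.-1 %/ 2)%N.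

Local Notation level_ind := (level_ind p q t).
Local Notation class_ind := (class_ind p q t).

Let p_gt0 : (0 < p)%N := prime_gt0 p_pr.
Let q_gt0 : (0 < q)%N := prime_gt0 q_pr.

Lemma level_indS i j a : level_ind i j.+1 a -> level_ind i j a.
Proof.
case/andP => jt; rewrite expnSr mulnA.
move=> /(dvdn_trans (dvdn_mulr _ (dvdnn _))) d.
by rewrite /level_ind ltnW.
Qed.

Lemma class_indS e i j a : class_ind e i j.+1 a -> class_ind e i j a.
Proof. by case/andP => /level_indS lv r; rewrite /class_ind lv. Qed.

Lemma dvdn_half_char x : (p %| x)%N = (half_char p x == 0).
Proof.
have [h_odd _ _] := half_pred_3mod4 p_pr p34.
by rewrite (dvdn_pcharf (pchar_Fp p_pr)) /half_char expf_eq0 odd_gt0.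
Qed.

Lemma half_char_case x :
  half_char p x = 0 \/ exists e : bool, half_char p x = (-1) ^+ e.
Proof.
have [/eqP|x_nz] := boolP (half_char p x == 0); [by left | right].
apply: (Fp_half_expr p_pr p34); apply: contra_neq x_nz => x0.
by apply/eqP; rewrite -dvdn_half_char (dvdn_pcharf (pchar_Fp p_pr)) x0.
Qed.

Lemma level_ind_succ i j a :
  level_ind i j a -> level_ind i.+1 j a = (half_char p (a %/ p ^ i) == 0).
Proof.
case/andP => jt /dvdnP [w ->]; rewrite -dvdn_half_char /level_ind jt /= expnS.
have -> : (w * (p ^ i * q ^ j) = p ^ i * (w * q ^ j))%N by rewrite mulnCA.
rewrite mulKn ?expn_gt0 ?p_gt0 //.
have -> : (p * p ^ i * q ^ j = p ^ i * (p * q ^ j))%N.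
  by rewrite (mulnC p) mulnA.
rewrite dvdn_pmul2l ?expn_gt0 ?p_gt0 // dvdn_pmul2r ?expn_gt0 ?q_gt0 //.
by rewrite Gauss_dvdl // coprimeXr // prime_coprime // dvdn_prime2.
Qed.

Lemma level_ind_leS i j a : level_ind i.+1 j a -> level_ind i j a.
Proof.
case/andP => jt d; rewrite /level_ind jt /=.
by apply: dvdn_trans d; rewrite expnS -mulnA dvdn_mull.
Qed.

(** A multiple of p^i q^j either is divisible by one more p or has a quotient of character 1 or -1.
    Sums over rows telescope by this identity. *)
Lemma level_ind_split (R : nzRingType) i j a :
  (level_ind i j a)%:R = (class_ind false i j a)%:R + (class_ind true i j a)%:R
                         + (level_ind i.+1 j a)%:R :> R.
Proof.
rewrite /class_ind; case lv: (level_ind i j a); last first.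
  by rewrite !add0r (contraFF (@level_ind_leS i j a) lv).
rewrite level_ind_succ // !andTb.
have [->|[e ->]] := half_char_case (a %/ p ^ i).
  by rewrite eqxx !(eq_sym 0) !signr_eq0 !add0r.
by rewrite !(Fp_sign_inj p_pr p34) signr_eq0; case: e; rewrite ?addr0 ?add0r.
Qed.

(** With n = Q p gam, the geometric factor has Q terms and vanishes unless Q divides a. For a = Q
    a', the other factor sums beta^(-a' w) over one quadratic class: it is h when p divides a',
    which is level k + 1, and a period otherwise. *)
Lemma sum_class_ind (L : fieldType) (s : nat) (alpha : L) (e : bool)
    (i j a : nat) :
  half_char p q = 1 ->
  (p ^ s * q ^ t)%N.-primitive_root alpha -> (i < s)%N -> (j <= t)%N ->
  let beta := alpha ^+ (p ^ s.-1 * q ^ t) in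
  let k := (s - i.+1)%N in let m := (t - j)%N in
  \sum_(u < p ^ s * q ^ t | class_ind e i j u) alpha ^- (a * u)
  = (p ^ k * q ^ m)%:R *
    (h%:R * (level_ind k.+1 m a)%:R
     + period p beta (~~ e) * (class_ind false k m a)%:R
     + period p beta e * (class_ind true k m a)%:R).
Proof.
move=> leg_q alpha_prim lt_is le_jt beta k m.
set n := (p ^ s * q ^ t)%N in alpha_prim *.
have [h_odd h2 p_gt2] := half_pred_3mod4 p_pr p34.
set gam := (p ^ i * q ^ j)%N; set Q := (p ^ k * q ^ m)%N.
have gam_gt0 : (0 < gam)%N by rewrite muln_gt0 !expn_gt0 p_gt0 q_gt0.
have Q_gt0 : (0 < Q)%N by rewrite muln_gt0 !expn_gt0 p_gt0 q_gt0.
have Qgam : (Q * gam = p ^ s.-1 * q ^ t)%N.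
  rewrite mulnACA -!expnD subnK //; congr (p ^ _ * _)%N.
  by rewrite /k; lia.
have nE : n = (Q * p * gam)%N.
  rewrite mulnAC Qgam mulnAC -expnSr prednK //; exact: leq_ltn_trans lt_is.
have le_mt : (m <= t)%N by rewrite leq_subr.
have leg_quot b x y := @half_char_quotient p q x y b p_gt0 q_gt0 leg_q.
pose z := (alpha^-1 ^+ a) ^+ gam.
have alphaV_n : alpha^-1 ^+ n = 1.
  by rewrite exprVn (prim_expr_order alpha_prim) invr1.
have -> : \sum_(u < n | class_ind e i j u) alpha ^- (a * u)
    = \sum_(0 <= w < Q * p | half_char p w == (-1) ^+ e) z ^+ w.
  transitivity (\sum_(0 <= u < Q * p * gam
      | (gam %| u)%N && (half_char p (u %/ p ^ i) == (-1) ^+ e))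
      (alpha^-1 ^+ a) ^+ u).
    rewrite -nE big_mkord; apply: eq_big => u.
      by rewrite /class_ind /level_ind le_jt.
    by rewrite -exprM exprVn.
  rewrite sum_multiples //; apply: eq_big => [w|w _]; last by rewrite exprM.
  by rewrite (leg_quot _ i j (dvdn_mulr w (dvdnn gam))) mulKn.
rewrite sum_residues; last first.
  by move=> w; rewrite (half_char_modn p_pr (modn_mod w p)).
rewrite sum_unity_root_expr; last first.
  have -> : z ^+ p ^+ Q = alpha^-1 ^+ n ^+ a.
    by rewrite /z -!exprM; congr (_ ^+ _); rewrite nE; ring.
  by rewrite alphaV_n expr1n.
have -> : (z ^+ p == 1) = (Q %| a)%N.
  have -> : z ^+ p = (alpha ^+ (a * (p * gam)))^-1.
    by rewrite /z -!exprM exprVn; congr (_ ^+ _)^-1; ring.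
  rewrite invr_eq1 -(prim_order_dvd alpha_prim) nE -mulnA.
  by rewrite dvdn_pmul2r // muln_gt0 gam_gt0 p_gt0.
have levE : level_ind k m a = (Q %| a)%N by rewrite /level_ind le_mt.
case: ifP => Qa; last first.
  rewrite mul0r /class_ind levE Qa /=.
  have -> : level_ind k.+1 m a = false.
    apply: contraFF Qa => /andP [_]; apply: dvdn_trans.
    by rewrite expnS -mulnA dvdn_mull.
  by rewrite !mulr0 !addr0 mulr0.
congr (_ * _).
have beta_p : beta ^+ p = 1.
  rewrite /beta -exprM -Qgam mulnAC -nE; exact: prim_expr_order alpha_prim.
have /dvdnP [a' aE] := Qa.
(* b represents -a' modulo p by a natural number. *)
pose b := (a' * p.-1)%N.
have zE : z = beta ^+ b.
  have beta_nz : beta != 0.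
    apply: contra_eq_neq beta_p => ->.
    by rewrite expr0n gtn_eqF // eq_sym oner_eq0.
  apply: (mulfI (expf_neq0 a' beta_nz)).
  rewrite -exprD /b -mulnS prednK // mulnC exprM beta_p expr1n.
  have -> : z = (beta ^+ a')^-1.
    rewrite /z aE -exprM exprVn /beta -exprM -Qgam.
    by congr (_ ^+ _)^-1; ring.
  by rewrite divff // expf_neq0.
under eq_bigr do rewrite zE -exprM.
rewrite (sum_half_class p_pr p34 beta_p).
have leg_a : half_char p (a %/ p ^ k) = half_char p a'.
  by rewrite (leg_quot _ k m) // aE mulnK.
(* -1 is a nonresidue: this is where [e] and [~~ e] get exchanged. *)
have leg_b : half_char p b = - half_char p a'.
  rewrite half_charM /half_char; have -> : p.-1%:R = -1 :> 'F_p.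
    apply/eqP; rewrite -addr_eq0 -[1]/(1%:R) -natrD addn1 prednK //.
    by rewrite -(dvdn_pcharf (pchar_Fp p_pr)).
  by rewrite -(signr_odd _ h) h_odd mulrN1.
have lvk : level_ind k m a by rewrite levE.
rewrite /class_ind lvk (level_ind_succ lvk) leg_a dvdn_half_char leg_b.
rewrite oppr_eq0 !andTb.
have [->|[e' ->]] := half_char_case a'.
  by rewrite eqxx !(eq_sym 0) !signr_eq0 !mulr0 !addr0 mulr1.
have -> : (- (-1) ^+ e' == 1 :> 'F_p) = e'.
  have -> : - (-1) ^+ e' = (-1) ^+ (~~ e') :> 'F_p.
    by case: e'; rewrite ?expr0 ?expr1 ?opprK.
  have := Fp_sign_inj p_pr p34 (~~ e') false; rewrite expr0 => ->.
  by case: (e').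
rewrite !(Fp_sign_inj p_pr p34) signr_eq0.
by case: e'; rewrite !(mulr0, mulr1, addr0, add0r).
Qed.

(** Level s carries no quadratic condition, so the sum is geometric. Its ratio is a root of unity of
    order dividing q^(t - j), which puts no condition at p on a: hence level 0 on the right. *)
Lemma sum_level_ind (L : fieldType) (s : nat) (alpha : L) (j a : nat) :
  (p ^ s * q ^ t)%N.-primitive_root alpha -> (j <= t)%N ->
  \sum_(u < p ^ s * q ^ t | level_ind s j u) alpha ^- (a * u)
  = (q ^ (t - j))%:R * (level_ind 0 (t - j) a)%:R.
Proof.
move=> alpha_prim le_jt; set n := (p ^ s * q ^ t)%N in alpha_prim *.
set gam := (p ^ s * q ^ j)%N; set Q := (q ^ (t - j))%N.
have gam_gt0 : (0 < gam)%N by rewrite muln_gt0 !expn_gt0 p_gt0 q_gt0.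
have nE : n = (Q * gam)%N by rewrite mulnCA -expnD subnK.
transitivity (\sum_(0 <= u < Q * gam | (gam %| u)%N && true)
    (alpha^-1 ^+ a) ^+ u).
  rewrite -nE big_mkord; apply: eq_big => u.
    by rewrite /level_ind le_jt andbT.
  by rewrite -exprM exprVn.
rewrite sum_multiples // big_mkord.
under eq_bigr do rewrite exprM.
have zE : (alpha^-1 ^+ a) ^+ gam = (alpha ^+ (a * gam))^-1.
  by rewrite -exprM exprVn.
rewrite sum_unity_root_expr zE; last first.
  rewrite exprVn -exprM -mulnA (mulnC gam) -nE mulnC exprM.
  by rewrite (prim_expr_order alpha_prim) expr1n invr1.
rewrite invr_eq1 -(prim_order_dvd alpha_prim) nE dvdn_pmul2r //.
rewrite /level_ind leq_subr expn0 mul1n -/Q.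
by case: ifP; rewrite ?mulr1 ?mulr0.
Qed.

End Indicators.

Lemma natr_andN (R : nzRingType) (A B : bool) :
  (B -> A) -> (A && ~~ B)%:R = A%:R - B%:R :> R.
Proof.
by case: A; case: B => BA; rewrite ?subrr ?subr0 //; have := BA isT.
Qed.

(** One natural residue modulo n replaces the integer g for both moduli p^s and q^t. *)
Lemma intr_Zp_modz (N n : nat) (g : int) :
  (1 < N)%N -> (0 < n)%N -> (N %| n)%N ->
  g%:~R = `|(g %% n%:Z)%Z|%N%:R :> 'Z_N.
Proof.
move=> N_gt1 n_gt0 /dvdnP [c nE]; rewrite {}nE in n_gt0 *.
have nz : (c * N)%N%:Z != 0 by rewrite eqz_nat -lt0n.
rewrite {1}(divz_eq g (c * N)%N%:Z) rmorphD rmorphM /= -!pmulrn.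
rewrite natrM pchar_Zp // !mulr0 add0r.
by rewrite -[X in X%:~R]gez0_abs ?modz_ge0.
Qed.

(** * The idempotents of length [p ^ s * q ^ t] *)

Section PrimitiveIdempotents.

Variables (s t p q l : nat).
Hypotheses (s_gt0 : (1 <= s)%N) (t_gt0 : (1 <= t)%N).
Hypotheses (p_pr : prime p) (q_pr : prime q).
Hypotheses (pq : p != q) (p34 : (p = 3 %[mod 4])%N).
Hypothesis ord_p : is_mult_order (p ^ s) l (totient (p ^ s) %/ 2).
Hypothesis ord_q : is_mult_order (q ^ t) l (totient (q ^ t)).
Hypothesis gcd_tot : gcdn (totient (p ^ s)) (totient (q ^ t)) = 2%N.
Hypothesis q_res : (q%:R : 'F_p) \in quad_res p.

Local Notation n := (p ^ s * q ^ t)%N.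
Local Notation h := (p.-1 %/ 2)%N.
Local Notation m := (totient (p ^ s) %/ 2)%N.
Local Notation leg := (half_char p).

(** * Cosets modulo n through the powers of l *)

Let h_odd : odd h. Proof. by case: (half_pred_3mod4 p_pr p34). Qed.
Let h2 : (h * 2 = p.-1)%N. Proof. by case: (half_pred_3mod4 p_pr p34). Qed.
Let p_gt2 : (2 < p)%N. Proof. by case: (half_pred_3mod4 p_pr p34). Qed.
Let p_gt0 : (0 < p)%N := prime_gt0 p_pr.
Let q_gt0 : (0 < q)%N := prime_gt0 q_pr.

Let mE : m = (p ^ s.-1 * h)%N.
Proof.
have d2 : (2 %| p.-1)%N by apply/dvdnP; exists h.
by rewrite totient_pfactor // muln_divA // mulnC.
Qed.

Let m2 : (totient (p ^ s) = m * 2)%N.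
Proof. by rewrite mE totient_pfactor // -mulnA h2 mulnC. Qed.

(** m is the order of l modulo p^s. Being odd, it keeps -1 out of the powers of l and is coprime to
    [totient (q ^ t)]. *)
Let m_odd : odd m.
Proof.
have p_odd : odd p by move: p34; lia.
by rewrite mE oddM h_odd andbT oddX p_odd orbT.
Qed.

Let ps_gt1 : (1 < p ^ s)%N.
Proof. by rewrite -[1%N](expn0 p) ltn_exp2l // ltnW. Qed.

Let qt_gt1 : (1 < q ^ t)%N.
Proof. by rewrite -[1%N](expn0 q) ltn_exp2l // prime_gt1. Qed.

Let co_pq : coprime p q.
Proof. by rewrite prime_coprime // dvdn_prime2. Qed.

Let co_psl : coprime (p ^ s) l. Proof. exact: coprime_prim_root_Zp ord_p. Qed.
Let co_qtl : coprime (q ^ t) l. Proof. exact: coprime_prim_root_Zp ord_q. Qed.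

Let dvd_pps : (p %| p ^ s)%N. Proof. by rewrite dvdn_exp. Qed.

(** l^m = 1 modulo p with m = h p^(s - 1), and raising to the power p is trivial in 'F_p, so l^h =
    1. *)
Lemma half_char_l : leg l = 1.
Proof.
have : l%:R ^+ m = 1 :> 'F_p.
  apply/eqP; rewrite -natrX -[1]/(1%:R) eq_Fp_nat //.
  rewrite -(modn_dvdm _ dvd_pps) -[X in _ == X](modn_dvdm _ dvd_pps).
  rewrite -/(_ == 1 %[mod p ^ s])%N.
  have := prim_expr_order (mult_order_nat ord_p).
  by rewrite -natrX -[1]/(1%:R) => /eqP; rewrite eq_Zp_nat // => /eqP ->.
rewrite mE mulnC exprM /half_char.
elim: s.-1 => [|k IH]; first by rewrite expr1.
rewrite expnS exprM.
by have := expf_card ((l%:R : 'F_p) ^+ h); rewrite card_Fp // => ->.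
Qed.

Lemma half_char_sign w : coprime p w -> exists e : bool, leg w = (-1) ^+ e.
Proof.
move=> cw; apply: (Fp_half_expr p_pr p34).
by rewrite -(dvdn_pcharf (pchar_Fp p_pr)) -prime_coprime.
Qed.

Lemma half_char_coprime w (e : bool) : leg w = (-1) ^+ e -> coprime p w.
Proof.
move/(half_expr_neq0 p_pr p34).
by rewrite -(dvdn_pcharf (pchar_Fp p_pr)) -prime_coprime.
Qed.

(* The powers of [l] and their opposites are [totient (p^s)] distinct units. *)
Lemma residue_expr w : leg w = 1 -> exists r, (w = l ^ r %[mod p ^ s])%N.
Proof.
move=> lw; have cw : coprime p w by apply: (half_char_coprime (e := false)).
have z_prim := mult_order_nat ord_p; set z : 'Z_(p ^ s) := l%:R in z_prim.
have z_unit : z \is a GRing.unit by rewrite unitZpE.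
have m_gt0 := prim_order_gt0 z_prim.
have zm := prim_expr_order z_prim.
have N11 : (-1 == 1 :> 'Z_(p ^ s)) = false.
  rewrite eq_sym -subr_eq0 opprK -[1 + 1](natrD _ 1 1) -[0]/(0%:R) eq_Zp_nat //.
  by rewrite mod0n; apply/negP => /(dvdn_trans dvd_pps); rewrite gtnNdvd.
pose f (x : bool * 'I_m) : 'Z_(p ^ s) := (-1) ^+ x.1 * z ^+ x.2.
have f_inj : injective f.
  move=> [e r] [e' r']; rewrite /f /= => eqf.
  have : ((-1) ^+ e * z ^+ r) ^+ m = ((-1) ^+ e' * z ^+ r') ^+ m by rewrite eqf.
  rewrite !exprMn -!exprM !(mulnC _ m) !exprM zm !expr1n !mulr1.
  have mm1 : (-1) ^+ m = -1 :> 'Z_(p ^ s) by rewrite -signr_odd m_odd.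
  rewrite mm1 => /eqP ee.
  have {}ee : e = e'.
    move: ee; case: (e); case: (e'); rewrite ?expr0 ?expr1 ?N11 //.
    by rewrite eq_sym N11.
  move: eqf; rewrite -ee => /(mulrI (unitrX _ (unitrN1 _))) /eqP.
  rewrite (eq_prim_root_expr z_prim) !modn_small // => /eqP /val_inj -> //.
have f_unit x : f x \is a GRing.unit by rewrite unitrM !unitrX ?unitrN1.
have cardT : #|{: bool * 'I_m}| = totient (p ^ s).
  by rewrite card_prod card_bool card_ord mulnC -m2.
have w_unit : (w%:R : 'Z_(p ^ s)) \is a GRing.unit.
  by rewrite unitZpE // coprimeXl.
have [[[] r]] := unit_Zp_exhaust ps_gt1 f_inj f_unit cardT w_unit.
  rewrite /f /= expr1 mulN1r => /eqP.
  rewrite eq_sym -addr_eq0 /z -natrX -natrD -[0]/(0%:R) eq_Zp_nat //.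
  rewrite mod0n => pw.
  have /dvdn_trans/(_ pw) : (p %| p ^ s)%N := dvd_pps.
  rewrite (dvdn_pcharf (pchar_Fp p_pr)) natrD addr_eq0 => /eqP wl.
  have := lw; rewrite /half_char wl exprNn -signr_odd h_odd -/(leg _).
  rewrite half_charX half_char_l expr1n mulr1 expr1 => /eqP.
  by rewrite (Fp_sign_inj p_pr p34 true false).
rewrite /f /= expr0 mul1r /z -natrX => /eqP; rewrite eq_Zp_nat // => /eqP e.
by exists r.
Qed.

Lemma coprime_expr w : coprime q w -> exists r, (w = l ^ r %[mod q ^ t])%N.
Proof.
move=> cw.
have z_prim := mult_order_nat ord_q; set z : 'Z_(q ^ t) := l%:R in z_prim.
pose f (r : 'I_(totient (q ^ t))) : 'Z_(q ^ t) := z ^+ r.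
have f_inj : injective f.
  move=> r r' /eqP; rewrite (eq_prim_root_expr z_prim) !modn_small // => /eqP.
  exact: val_inj.
have f_unit r : f r \is a GRing.unit by rewrite unitrX // unitZpE.
have w_unit : (w%:R : 'Z_(q ^ t)) \is a GRing.unit.
  by rewrite unitZpE // coprimeXl.
have [r /eqP] := unit_Zp_exhaust qt_gt1 f_inj f_unit (card_ord _) w_unit.
by rewrite /f /z -natrX eq_Zp_nat // => /eqP e; exists r.
Qed.

Lemma simultaneous_expr r1 r2 : exists r,
  (l ^ r = l ^ r1 %[mod p ^ s])%N /\ (l ^ r = l ^ r2 %[mod q ^ t])%N.
Proof.
(* The gcd divides both 2 and the odd number m. The Chinese remainder theorem then applies to the
   exponents of l. *)
have co : coprime m (totient (q ^ t)).
  have : (gcdn m (totient (q ^ t))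
      %| gcdn (totient (p ^ s)) (totient (q ^ t)))%N.
    rewrite dvdn_gcd dvdn_gcdr andbT (dvdn_trans (dvdn_gcdl _ _)) //.
    by rewrite [X in (_ %| X)%N]m2 dvdn_mulr.
  rewrite gcd_tot.
  rewrite /coprime; have := dvdn_gcdl m (totient (q ^ t)).
  case: (gcdn _ _) => [|[|[|]]] //.
  by rewrite dvdn2 m_odd.
exists (chinese m (totient (q ^ t)) r1 r2); split; apply/eqP.
  rewrite -eq_Zp_nat // !natrX (eq_prim_root_expr (mult_order_nat ord_p)).
  by rewrite chinese_modl.
rewrite -eq_Zp_nat // !natrX (eq_prim_root_expr (mult_order_nat ord_q)).
by rewrite chinese_modr.
Qed.

Let coset_split i j : (i <= s)%N -> (j <= t)%N ->
  n = (p ^ i * q ^ j * (p ^ (s - i) * q ^ (t - j)))%N.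
Proof.
move=> i_s j_t; rewrite mulnACA -!expnD !subnKC //.
Qed.

Let leg_q : leg q = 1.
Proof. by move: q_res; rewrite mem_quad_res // => /eqP. Qed.

(** After division by p^i q^j the congruence lives modulo n' = p^(s - i) q^(t - j); the guards drop
    the condition at a prime that no longer divides n'. Conversely, a / (p^i q^j) times an inverse
    of [eps] is a power of l modulo each prime power, and the two exponents can be made equal. *)
Lemma mem_coset_char eps i j (a : 'I_n) :
  coprime n eps -> (i <= s)%N -> (j <= t)%N ->
  (a \in ccoset n l (p ^ i * q ^ j * eps)%N) =
  [&& (p ^ i * q ^ j %| a)%N,
      (i < s)%N ==> (leg (a %/ p ^ i) == leg eps) &
      (j < t)%N ==> ~~ (p ^ i * q ^ j.+1 %| a)%N].
Proof.
move=> co_eps i_s j_t.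
set gam := (p ^ i * q ^ j)%N; set n' := (p ^ (s - i) * q ^ (t - j))%N.
have nE : n = (gam * n')%N := coset_split i_s j_t.
have gam_gt0 : (0 < gam)%N by rewrite muln_gt0 !expn_gt0 p_gt0 q_gt0.
have pn' : (i < s)%N -> (p %| n')%N.
  by move=> lt_is; rewrite dvdn_mulr // dvdn_exp // subn_gt0.
have qn' : (j < t)%N -> (q %| n')%N.
  by move=> lt_jt; rewrite dvdn_mull // dvdn_exp // subn_gt0.
have n'n : (n' %| n)%N by rewrite nE dvdn_mull.
have co_l : coprime n l by rewrite coprimeMl co_psl.
have modl d x y : (d %| n')%N -> (x = y %[mod n'])%N -> (x = y %[mod d])%N.
  by move=> dn e; rewrite -(modn_dvdm _ dn) e modn_dvdm.
apply/mem_ccoset_nat/and3P => [[r ar]|[/dvdnP [w aw] leg_a q_a]].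
  have gam_a : (gam %| a)%N.
    have : (a == 0 %[mod gam])%N.
      have gn : (gam %| n)%N by rewrite nE dvdn_mulr.
      by rewrite -(modn_dvdm _ gn) ar modn_dvdm // -mulnA modnMr mod0n.
    by rewrite mod0n.
  case/dvdnP: (gam_a) => w aw; have wr : (w = eps * l ^ r %[mod n'])%N.
    have : (gam * w = gam * (eps * l ^ r) %[mod gam * n'])%N.
      by rewrite -nE mulnA [(gam * w)%N]mulnC -aw.
    by rewrite -!muln_modr => /eqP; rewrite eqn_pmul2l // => /eqP.
  split=> //; [apply/implyP => lt_is | apply/implyP => lt_jt].
    rewrite (half_char_quotient p_gt0 q_gt0 leg_q gam_a) aw mulnK //.
    rewrite (half_char_modn p_pr (modl _ _ _ (pn' lt_is) wr)).
    by rewrite half_charM half_charX half_char_l expr1n mulr1.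
  rewrite expnSr mulnA aw mulnC dvdn_pmul2r //.
  have -> : (q %| w)%N = (w == 0 %[mod q])%N by rewrite mod0n.
  rewrite (modl _ _ _ (qn' lt_jt) wr) mod0n -prime_coprime //.
  rewrite coprimeMr; have q_n : (q %| n)%N := dvdn_trans (qn' lt_jt) n'n.
  by rewrite coprimeXr ?(coprime_dvdl q_n).
have [eps' eps'K] : exists eps', (eps * eps' = 1 %[mod n])%N.
  exists (eps ^ (totient n).-1)%N; rewrite -expnS prednK.
    by rewrite Euler_exp_totient // coprime_sym.
  by rewrite totient_gt0 muln_gt0 !expn_gt0 p_gt0 q_gt0.
have eps'K' d : (d %| n)%N -> (eps * eps' = 1 %[mod d])%N.
  by move=> dn; rewrite -(modn_dvdm _ dn) eps'K modn_dvdm.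
have gam_a : (gam %| a)%N by apply/dvdnP; exists w.
have [r1 wr1] : exists r1, (w * eps' = l ^ r1 %[mod p ^ (s - i)])%N.
  case: (ltnP i s) => [lt_is|ge_is]; last first.
    (* For i = s the modulus is 1, so any exponent will do. *)
    by exists 0%N; move: ge_is; rewrite -subn_eq0 => /eqP ->; rewrite !modn1.
  have p_n : (p %| n)%N by apply: dvdn_trans (pn' lt_is) n'n.
  have [|r1 e] := @residue_expr (w * eps')%N.
    rewrite half_charM; move: leg_a.
    rewrite lt_is (half_char_quotient p_gt0 q_gt0 leg_q gam_a) aw mulnK //.
    move=> /eqP ->; rewrite -half_charM.
    by rewrite (half_char_modn p_pr (eps'K' _ p_n)) /half_char expr1n.
  have dps : (p ^ (s - i) %| p ^ s)%N by rewrite dvdn_exp2l // leq_subr.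
  by exists r1; rewrite -(modn_dvdm _ dps) e modn_dvdm.
have [r2 wr2] : exists r2, (w * eps' = l ^ r2 %[mod q ^ (t - j)])%N.
  case: (ltnP j t) => [lt_jt|ge_jt]; last first.
    by exists 0%N; move: ge_jt; rewrite -subn_eq0 => /eqP ->; rewrite !modn1.
  have q_n : (q %| n)%N by apply: dvdn_trans (qn' lt_jt) n'n.
  have [|r2 e] := @coprime_expr (w * eps')%N.
    rewrite coprimeMr; apply/andP; split.
      rewrite prime_coprime //; apply: contraL q_a => /= qw.
      by rewrite lt_jt negbK expnSr mulnA aw mulnC dvdn_pmul2r.
    have : coprime q (eps * eps').
      by rewrite -coprime_modr eps'K' // coprime_modr coprimen1.
    by rewrite coprimeMr => /andP [].
  have dqt : (q ^ (t - j) %| q ^ t)%N by rewrite dvdn_exp2l // leq_subr.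
  by exists r2; rewrite -(modn_dvdm _ dqt) e modn_dvdm.
have [r [er1 er2]] := simultaneous_expr r1 r2; exists r.
have wr : (w * eps' = l ^ r %[mod n'])%N.
  apply/eqP; rewrite chinese_remainder ?coprimeXl ?coprimeXr //.
  have dps : (p ^ (s - i) %| p ^ s)%N by rewrite dvdn_exp2l // leq_subr.
  have dqt : (q ^ (t - j) %| q ^ t)%N by rewrite dvdn_exp2l // leq_subr.
  rewrite wr1 wr2 -(modn_dvdm (l ^ r) dps) er1 modn_dvdm // eqxx.
  by rewrite -(modn_dvdm (l ^ r) dqt) er2 modn_dvdm // eqxx.
rewrite aw [(w * gam)%N]mulnC -mulnA [X in (_ = _ %[mod X])%N]nE -!muln_modr.
congr (_ * _)%N.
by rewrite -modnMmr -wr modnMmr mulnCA -modnMmr eps'K' // modnMmr muln1.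
Qed.

(** With character 1, w would be a power of l modulo p^s, and its order would divide m, half of the
    totient. Hence multiplication by g leads to the other class. *)
Lemma primitive_root_half_char w :
  (totient (p ^ s)).-primitive_root (w%:R : 'Z_(p ^ s)) -> leg w = -1.
Proof.
move=> w_prim; have w_unit := coprime_prim_root_Zp ps_gt1 w_prim.
have [[] lw] := @half_char_sign w (coprime_dvdl dvd_pps w_unit).
  by rewrite lw.
have [r e] := @residue_expr w lw.
have : (totient (p ^ s) %| m)%N.
  rewrite (prim_order_dvd w_prim).
  have /eqP -> : (w%:R == (l ^ r)%:R :> 'Z_(p ^ s)).
    by rewrite eq_Zp_nat //; apply/eqP.
  by rewrite natrX exprAC (prim_expr_order (mult_order_nat ord_p)) expr1n.
have m_gt0 := prim_order_gt0 (mult_order_nat ord_p).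
move/dvdn_leq => /(_ m_gt0); rewrite [X in (X <= _)%N]m2.
by rewrite -[X in (_ <= X)%N]muln1 leq_pmul2l.
Qed.

Lemma mem_coset_class (e : bool) eps i j (a : 'I_n) :
  coprime n eps -> leg eps = (-1) ^+ e -> (i < s)%N -> (j <= t)%N ->
  (a \in ccoset n l (p ^ i * q ^ j * eps)%N)
  = class_ind p q t e i j a && ~~ class_ind p q t e i j.+1 a.
Proof.
move=> co_eps leg_eps lt_is le_jt.
rewrite mem_coset_char ?(ltnW lt_is) // lt_is leg_eps.
rewrite /class_ind /level_ind le_jt.
case: (_ %| _)%N => //=; case: eqP => _ //=.
by rewrite ?andbT ?andbF implybE negb_and.
Qed.

Lemma mem_coset_level eps j (a : 'I_n) :
  coprime n eps -> (j <= t)%N ->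
  (a \in ccoset n l (p ^ s * q ^ j * eps)%N)
  = level_ind p q t s j a && ~~ level_ind p q t s j.+1 a.
Proof.
move=> co_eps le_jt; rewrite mem_coset_char // ltnn /level_ind le_jt.
by rewrite /= implybE negb_and.
Qed.

Variables (g : int) (L : fieldType) (iota : {rmorphism 'F_l -> L}) (alpha : L).
Hypotheses (l_pr : prime l) (pl : p != l).
Hypothesis g_p : is_primitive_root_mod (p ^ s) g.
Hypothesis g_q : is_primitive_root_mod (q ^ t) g.
Hypothesis alpha_prim : (p ^ s * q ^ t)%N.-primitive_root alpha.

Local Notation beta := (alpha ^+ (p ^ s.-1 * q ^ t)).
Local Notation level_ind := (level_ind p q t).
Local Notation class_ind := (class_ind p q t).

(* The Boolean [e] distinguishes the starred cosets: it is the exponent in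
   [(-1)^e = (a / p^i)^h]. *)
Definition coset_leader (e : bool) (i j : nat) : int :=
  if e then (p ^ i * q ^ j)%N%:Z * g else (p ^ i * q ^ j)%N%:Z.

Local Notation coset_chi e i j := (chi n l (coset_leader e i j)).

Let n_gt0 : (0 < n)%N := prim_order_gt0 alpha_prim.

(** Treats both kinds of coset alike: [eps] is 1, or the natural residue of g modulo n. *)
Let leader_nat (e : bool) : exists eps, [/\ coprime n eps,
  half_char p eps = (-1) ^+ e &
  forall i j, ccoset n l (coset_leader e i j)
    = ccoset n l (p ^ i * q ^ j * eps)%N].
Proof.
case: e; last first.
  exists 1%N; split=> [||i j]; first by rewrite coprimen1.
    by rewrite /half_char expr1n.
  by rewrite muln1.
exists `|(g %% n%:Z)%Z|%N; set g0 := absz _.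
have g0p : (g%:~R : 'Z_(p ^ s)) = g0%:R.
  by apply: intr_Zp_modz; rewrite ?dvdn_mulr.
have g0q : (g%:~R : 'Z_(q ^ t)) = g0%:R.
  by apply: intr_Zp_modz; rewrite ?dvdn_mull.
move: g_p g_q; rewrite /is_primitive_root_mod /is_mult_order g0p g0q => gp gq.
split=> [||i j].
- by rewrite coprimeMl (coprime_prim_root_Zp ps_gt1 gp)
    (coprime_prim_root_Zp qt_gt1 gq).
- by rewrite (primitive_root_half_char gp).
- apply: ccoset_mod; rewrite (PoszM _ g0) /g0 gez0_abs ?modzMmr //.
  by rewrite modz_ge0 // eqz_nat -lt0n.
Qed.

(** * Coefficients of the sums of chi *)

Let X_class (e : bool) k j a : (a < n)%N -> (k < s)%N -> (j <= t)%N ->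
  qcoef a (coset_chi e k j)
  = (class_ind e k j a)%:R - (class_ind e k j.+1 a)%:R.
Proof.
move=> an ks jt; rewrite (qcoef_chi l n_gt0 _ an).
have [eps [co leg_eps ->]] := leader_nat e.
by rewrite (mem_coset_class _ co leg_eps) // natr_andN //; apply: class_indS.
Qed.

Let X_level (e : bool) j a : (a < n)%N -> (j <= t)%N ->
  qcoef a (coset_chi e s j) = (level_ind s j a)%:R - (level_ind s j.+1 a)%:R.
Proof.
move=> an jt; rewrite (qcoef_chi l n_gt0 _ an).
have [eps [co leg_eps ->]] := leader_nat e.
by rewrite mem_coset_level // natr_andN //; apply: level_indS.
Qed.

Let telescope_ind (f : nat -> bool) j (F : nat -> 'F_l) :
  (j <= t.+1)%N -> f t.+1 = false ->
  (forall m, (m <= t)%N -> F m = (f m)%:R - (f m.+1)%:R) ->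
  \sum_(j <= m < t.+1) F m = (f j)%:R.
Proof.
move=> jt ft Ff; rewrite -[RHS]subr0 -[0 in RHS]/(false%:R) -ft.
apply: oppr_inj; rewrite opprB -(telescope_sumr (fun m => (f m)%:R) jt) -sumrN.
apply: eq_big_nat => m /andP [_ mt].
by rewrite Ff // opprB.
Qed.

Let level_top i a : level_ind i t.+1 a = false.
Proof. by rewrite /level_ind ltnn. Qed.

Let sum_X_class (e : bool) k j a : (a < n)%N -> (k < s)%N -> (j <= t.+1)%N ->
  qcoef a (\sum_(j <= m < t.+1) coset_chi e k m) = (class_ind e k j a)%:R.
Proof.
move=> an ks jt; rewrite qcoef_sum.
rewrite (@telescope_ind (fun m => class_ind e k m a)) //.
  by rewrite /class_ind level_top.
by move=> m mt; rewrite X_class.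
Qed.

Let sum_X_level (e : bool) j a : (a < n)%N -> (j <= t.+1)%N ->
  qcoef a (\sum_(j <= m < t.+1) coset_chi e s m) = (level_ind s j a)%:R.
Proof.
move=> an jt; rewrite qcoef_sum (@telescope_ind (fun m => level_ind s m a)) //.
by move=> m mt; rewrite X_level.
Qed.

Let sum_classes k j a : (k <= s)%N ->
  \sum_(k <= i < s) ((class_ind false i j a)%:R + (class_ind true i j a)%:R)
  = (level_ind k j a)%:R - (level_ind s j a)%:R :> 'F_l.
Proof.
move=> ks; apply: oppr_inj.
rewrite opprB -(telescope_sumr (fun i => (level_ind i j a)%:R) ks) -sumrN.
apply: eq_bigr => i _.
by rewrite [(level_ind i j a)%:R](level_ind_split t p_pr p34 q_pr pq); ring.
Qed.

Let sum_X_block k j a : (a < n)%N -> (k <= s)%N -> (j <= t.+1)%N ->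
  qcoef a (\sum_(k <= i < s) \sum_(j <= m < t.+1)
    (coset_chi false i m + coset_chi true i m))
  = (level_ind k j a)%:R - (level_ind s j a)%:R.
Proof.
move=> an ks jt; rewrite qcoef_sum -sum_classes //.
apply: eq_big_nat => i /andP [_ lt_is].
by rewrite big_split qcoefD !sum_X_class.
Qed.

Let sum_X_row k j a : (a < n)%N -> (k <= s)%N -> (j <= t)%N ->
  qcoef a (\sum_(k <= i < s) (coset_chi false i j + coset_chi true i j))
  = (level_ind k j a)%:R - (level_ind s j a)%:R
    - ((level_ind k j.+1 a)%:R - (level_ind s j.+1 a)%:R).
Proof.
move=> an ks jt; rewrite qcoef_sum -!sum_classes // -sumrB.
apply: eq_big_nat => i /andP [_ lt_is].
by rewrite qcoefD !X_class // opprD addrACA.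
Qed.

(** The l-power map replaces beta by beta^l; as l is a residue modulo p, this only permutes the
    terms of each period. *)
Lemma period_in_Fp (e : bool) : {c : 'F_l | iota c = period p beta e}.
Proof.
apply: Fp_frobenius_fixed => //.
have lL : l \in [pchar L] by rewrite (rmorph_pchar iota) // pchar_Fp.
have beta_p : beta ^+ p = 1.
  rewrite -exprM mulnAC -expnSr prednK //; exact: prim_expr_order alpha_prim.
have p_l : (p %| l)%N = false by rewrite dvdn_prime2 // (negPf pl).
have := sum_half_class p_pr p34 beta_p e l.
rewrite p_l half_char_l eqxx => period_l; rewrite -[RHS]period_l.
rewrite (sum_Fp (fun x => x ^+ h == (-1) ^+ e) (fun w => beta ^+ (l * w)) p_pr).
rewrite -(pFrobenius_autE lL) /period rmorph_sum /=.
by apply: eq_bigr => x _; rewrite pFrobenius_autE (mulnC l) [RHS]exprM.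
Qed.

Definition period_Fp (e : bool) : 'F_l := sval (period_in_Fp e).

Lemma iota_period_Fp e : iota (period_Fp e) = period p beta e.
Proof. by rewrite /period_Fp; case: period_in_Fp. Qed.

(** The bracket of [sum_class_ind], descended to 'F_l. *)
Definition gauss_coef (e : bool) (k m a : nat) : 'F_l :=
  h%:R * (level_ind k.+1 m a)%:R
  + period_Fp (~~ e) * (class_ind false k m a)%:R
  + period_Fp e * (class_ind true k m a)%:R.

Definition theta (gamma : int) : cyclic_alg n l :=
  sval (ccoset_thetaP iota l_pr alpha_prim gamma).

Let iota_gauss_coef e k m a : iota (gauss_coef e k m a) =
  h%:R * (level_ind k.+1 m a)%:R
  + period p beta (~~ e) * (class_ind false k m a)%:R
  + period p beta e * (class_ind true k m a)%:R.
Proof.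
by rewrite /gauss_coef !(rmorphD, rmorphM, rmorph_nat) /= !iota_period_Fp.
Qed.

(** * Coefficients of the idempotents *)

Let theta_sum gamma a : (a < n)%N -> iota (n%:R * qcoef a (theta gamma))
  = \sum_(u in ccoset n l gamma) alpha ^- (a * u).
Proof.
move=> an; rewrite rmorphM rmorph_nat /theta.
by case: ccoset_thetaP => th [_ /= /(_ a an)].
Qed.

Let sum_indN (f f' : nat -> bool) (F : 'I_n -> L) :
  (forall u, f' u -> f u) ->
  \sum_(u : 'I_n | f u && ~~ f' u) F u
  = \sum_(u : 'I_n | f u) F u - \sum_(u : 'I_n | f' u) F u.
Proof.
move=> ff; rewrite [X in _ = X - _](bigID (fun u : 'I_n => f' u)) /=.
rewrite [X in _ = X + _ - _](eq_bigl (fun u : 'I_n => f' u)).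
  by rewrite addrAC subrr add0r.
by move=> u; case fu: (f' u); rewrite ?andbF ?andbT ?ff.
Qed.

(** n is nonzero in 'F_l because its image in [L] is, so its factor K may be cancelled. *)
Let solve_scaled (N K : nat) (x v : 'F_l) :
  n = (N * K)%N -> n%:R * x = K%:R * v -> x = N%:R^-1 * v.
Proof.
move=> nE; have : n%:R != 0 :> 'F_l.
  rewrite -(fmorph_eq0 iota) rmorph_nat.
  exact: prim_root_natf_neq0 alpha_prim.
rewrite nE natrM mulf_eq0 negb_or => /andP [N_nz K_nz] e.
by apply: (mulfI K_nz); rewrite [RHS]mulrCA -e -mulrA mulKf.
Qed.

Let theta_classN (e : bool) i j a : (a < n)%N -> (i < s)%N -> (j <= t)%N ->
  iota (n%:R * qcoef a (theta (coset_leader e i j)))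
  = \sum_(u < n | class_ind e i j u) alpha ^- (a * u)
    - \sum_(u < n | class_ind e i j.+1 u) alpha ^- (a * u).
Proof.
move=> an lt_is le_jt; rewrite theta_sum //.
have [eps [co leg_eps ->]] := leader_nat e.
rewrite (eq_bigl (fun u : 'I_n =>
  class_ind e i j u && ~~ class_ind e i j.+1 u)).
  by apply: sum_indN => u; apply: class_indS.
by move=> u; rewrite (mem_coset_class _ co leg_eps).
Qed.

Let theta_levelN j a : (a < n)%N -> (j <= t)%N ->
  iota (n%:R * qcoef a (theta (coset_leader false s j)))
  = \sum_(u < n | level_ind s j u) alpha ^- (a * u)
    - \sum_(u < n | level_ind s j.+1 u) alpha ^- (a * u).
Proof.
move=> an le_jt; rewrite theta_sum //.
have [eps [co leg_eps ->]] := leader_nat false.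
rewrite (eq_bigl (fun u : 'I_n => level_ind s j u && ~~ level_ind s j.+1 u)).
  by apply: sum_indN => u; apply: level_indS.
by move=> u; rewrite mem_coset_level.
Qed.

Lemma theta_class (e : bool) i j a : (a < n)%N -> (i < s)%N -> (j < t)%N ->
  qcoef a (theta (coset_leader e i j)) = (p ^ i.+1 * q ^ j.+1)%:R^-1 *
   (q%:R * gauss_coef e (s - i.+1) (t - j) a
    - gauss_coef e (s - i.+1) (t - j.+1) a).
Proof.
move=> an lt_is lt_jt.
apply: (solve_scaled (K := p ^ (s - i.+1) * q ^ (t - j.+1))).
  by rewrite mulnACA -!expnD !subnKC.
apply: (fmorph_inj iota); rewrite theta_classN ?(ltnW lt_jt) //.
rewrite !(sum_class_ind p_pr p34 q_pr pq e a leg_q alpha_prim) ?(ltnW lt_jt) //.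
rewrite -!iota_gauss_coef -!(rmorph_nat iota) -!rmorphM -rmorphB.
(* q^(t - j) = q q^(t - j - 1), so both unions share the factor K, and the first keeps an extra
   q. *)
by rewrite -(subnSK lt_jt) expnS mulnCA [in LHS]natrM -mulrA mulrCA -mulrBr.
Qed.

Lemma theta_class_top (e : bool) i a : (a < n)%N -> (i < s)%N ->
  qcoef a (theta (coset_leader e i t)) = (p ^ i.+1 * q ^ t)%:R^-1 *
    gauss_coef e (s - i.+1) 0 a.
Proof.
move=> an lt_is; apply: (solve_scaled (K := p ^ (s - i.+1))).
  by rewrite mulnAC -expnD subnKC.
apply: (fmorph_inj iota); rewrite theta_classN //.
rewrite (sum_class_ind p_pr p34 q_pr pq e a leg_q alpha_prim) //.
(* The union starting at column t + 1 is empty, so only one term remains. *)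
rewrite [X in _ - X]big1 ?subr0; last by move=> u; rewrite /class_ind level_top.
by rewrite subnn muln1 -iota_gauss_coef -(rmorph_nat iota) -rmorphM.
Qed.

Lemma theta_level j a : (a < n)%N -> (j < t)%N ->
  qcoef a (theta (coset_leader false s j)) = (p ^ s * q ^ j.+1)%:R^-1 *
   (q%:R * (level_ind 0 (t - j) a)%:R - (level_ind 0 (t - j.+1) a)%:R).
Proof.
move=> an lt_jt; apply: (solve_scaled (K := q ^ (t - j.+1))).
  by rewrite -mulnA -expnD subnKC.
apply: (fmorph_inj iota); rewrite theta_levelN ?(ltnW lt_jt) //.
rewrite !(sum_level_ind p_pr q_pr a alpha_prim) ?(ltnW lt_jt) //.
rewrite !(rmorphM, rmorphB, rmorph_nat).
by rewrite -(subnSK lt_jt) expnS [(q * _)%:R]natrM -mulrA mulrCA -mulrBr.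
Qed.

Lemma theta_level_top a : (a < n)%N ->
  qcoef a (theta (coset_leader false s t)) = (p ^ s * q ^ t)%:R^-1 * 1.
Proof.
move=> an; apply: (solve_scaled (K := 1)); first by rewrite muln1.
apply: (fmorph_inj iota); rewrite theta_levelN //.
rewrite (sum_level_ind p_pr q_pr a alpha_prim) //.
rewrite [X in _ - X]big1 ?subr0; last by move=> u; rewrite level_top.
by rewrite subnn /level_ind !expn0 dvd1n rmorphM rmorph_nat rmorph1.
Qed.

Let natr_pred_q : q.-1%:R = q%:R - 1 :> 'F_l.
Proof. by apply: (addIr 1); rewrite subrK natr1 prednK. Qed.

(** * The formulas, compared coefficient by coefficient *)

Lemma theta_0_top (e : bool) :
  theta (coset_leader e 0 t) = (p * q ^ t)%:R^-1 *:
    (h%:R *: (\sum_(0 <= m < t.+1) coset_chi false s m)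
     + period_Fp (~~ e) *: (\sum_(0 <= m < t.+1) coset_chi false s.-1 m)
     + period_Fp e *: (\sum_(0 <= m < t.+1) coset_chi true s.-1 m)).
Proof.
have lt_s : (s.-1 < s)%N by rewrite prednK.
apply: (qcoefP n_gt0) => a an; rewrite theta_class_top // !(qcoefZ, qcoefD).
rewrite sum_X_level // !sum_X_class // expn1; congr (_ * _).
by rewrite /gauss_coef subn1 prednK.
Qed.

Lemma theta_0 (e : bool) j : (j < t)%N ->
  theta (coset_leader e 0 j) = (p * q ^ j.+1)%:R^-1 *:
   ((h%:R * q.-1%:R) *: (\sum_(t - j <= m < t.+1) coset_chi false s m)
    + q.-1%:R *:
      (period_Fp (~~ e) *: (\sum_(t - j <= m < t.+1) coset_chi false s.-1 m)
       + period_Fp e *: (\sum_(t - j <= m < t.+1) coset_chi true s.-1 m))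
    - (period_Fp (~~ e) *: coset_chi false s.-1 (t - j - 1)%N
       + period_Fp e *: coset_chi true s.-1 (t - j - 1)%N)
    - h%:R *: coset_chi false s (t - j - 1)%N).
Proof.
move=> lt_jt; have lt_s : (s.-1 < s)%N by rewrite prednK.
have le1 : (t - j <= t.+1)%N by rewrite ltnW // ltnS leq_subr.
have le2 : (t - j.+1 <= t)%N by rewrite leq_subr.
apply: (qcoefP n_gt0) => a an; rewrite theta_class // -subnDA addn1.
rewrite !(qcoefZ, qcoefB, qcoefD) sum_X_level // !sum_X_class //.
rewrite X_level // !X_class // (subnSK lt_jt) expn1; congr (_ * _).
(* With A and B the values at columns t - j and t - j - 1, q A - B = (q - 1) A - (B - A), and B - A
   is the contribution of the single column t - j - 1. *)
by rewrite /gauss_coef subn1 prednK // natr_pred_q; ring.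
Qed.

(** The level s - i inside [gauss_coef] consists of all rows k from s - i to s; this produces the
    sums over k, in the block of columns from t - j on as well as in column t - j - 1. *)
Lemma theta_mid (e : bool) i j : (0 < i < s)%N -> (j < t)%N ->
  theta (coset_leader e i j) = (p ^ i.+1 * q ^ j.+1)%:R^-1 *:
   ((h%:R * q.-1%:R) *: ((\sum_(s - i <= k < s) \sum_(t - j <= m < t.+1)
                         (coset_chi false k m + coset_chi true k m))
                      + \sum_(t - j <= m < t.+1) coset_chi false s m)
    + q.-1%:R *:
      (period_Fp (~~ e) *:
         (\sum_(t - j <= m < t.+1) coset_chi false (s - i - 1)%N m)
       + period_Fp e *:
         (\sum_(t - j <= m < t.+1) coset_chi true (s - i - 1)%N m))
    - (period_Fp (~~ e) *: coset_chi false (s - i - 1)%N (t - j - 1)%N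
       + period_Fp e *: coset_chi true (s - i - 1)%N (t - j - 1)%N)
    - h%:R *: ((\sum_(s - i <= k < s)
                 (coset_chi false k (t - j - 1)%N
                  + coset_chi true k (t - j - 1)%N))
               + coset_chi false s (t - j - 1)%N)).
Proof.
move=> /andP [i_gt0 lt_is] lt_jt.
have lt_s : (s - i.+1 < s)%N by rewrite ltn_subrL.
have le1 : (t - j <= t.+1)%N by rewrite ltnW // ltnS leq_subr.
have le2 : (t - j.+1 <= t)%N by rewrite leq_subr.
have le3 : (s - i <= s)%N by rewrite leq_subr.
apply: (qcoefP n_gt0) => a an; rewrite theta_class // -!subnDA !addn1.
rewrite !(qcoefZ, qcoefB, qcoefD) sum_X_level // !sum_X_class // sum_X_block //.
rewrite sum_X_row // X_level // !X_class // (subnSK lt_jt); congr (_ * _).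
by rewrite /gauss_coef (subnSK lt_is) natr_pred_q; ring.
Qed.

Lemma theta_mid_top (e : bool) i : (0 < i < s)%N ->
  theta (coset_leader e i t) = (p ^ i.+1 * q ^ t)%:R^-1 *:
   (h%:R *: (\sum_(s - i <= k < s) \sum_(0 <= m < t.+1)
               (coset_chi false k m + coset_chi true k m))
    + h%:R *: (\sum_(0 <= m < t.+1) coset_chi false s m)
    + period_Fp (~~ e) *: (\sum_(0 <= m < t.+1) coset_chi false (s - i - 1)%N m)
    + period_Fp e *: (\sum_(0 <= m < t.+1) coset_chi true (s - i - 1)%N m)).
Proof.
move=> /andP [i_gt0 lt_is].
have lt_s : (s - i.+1 < s)%N by rewrite ltn_subrL.
have le3 : (s - i <= s)%N by rewrite leq_subr.
apply: (qcoefP n_gt0) => a an; rewrite theta_class_top // -!subnDA !addn1.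
rewrite !(qcoefZ, qcoefD) sum_X_level // !sum_X_class // sum_X_block //.
by congr (_ * _); rewrite /gauss_coef (subnSK lt_is); ring.
Qed.

Lemma theta_s j : (j < t)%N ->
  theta (coset_leader false s j) = (p ^ s * q ^ j.+1)%:R^-1 *:
   (q.-1%:R *: ((\sum_(0 <= k < s) \sum_(t - j <= m < t.+1)
                   (coset_chi false k m + coset_chi true k m))
          + \sum_(t - j <= m < t.+1) coset_chi false s m)
    - ((\sum_(0 <= k < s) (coset_chi false k (t - j - 1)%N
                           + coset_chi true k (t - j - 1)%N))
       + coset_chi false s (t - j - 1)%N)).
Proof.
move=> lt_jt.
have le1 : (t - j <= t.+1)%N by rewrite ltnW // ltnS leq_subr.
have le2 : (t - j.+1 <= t)%N by rewrite leq_subr.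
apply: (qcoefP n_gt0) => a an; rewrite theta_level // -!subnDA !addn1.
rewrite !(qcoefZ, qcoefB, qcoefD) sum_X_level // sum_X_block // sum_X_row //.
rewrite X_level // (subnSK lt_jt); congr (_ * _).
by rewrite natr_pred_q; ring.
Qed.

Lemma theta_s_top :
  theta (coset_leader false s t) = (p ^ s * q ^ t)%:R^-1 *:
   ((\sum_(0 <= k < s) \sum_(0 <= m < t.+1)
       (coset_chi false k m + coset_chi true k m))
    + \sum_(0 <= m < t.+1) coset_chi false s m).
Proof.
apply: (qcoefP n_gt0) => a an; rewrite theta_level_top // qcoefZ qcoefD.
rewrite sum_X_level // sum_X_block // subrK; congr (_ * _).
by rewrite /level_ind !expn0 dvd1n.
Qed.

Lemma theta_s_top_all_powers :
  theta (coset_leader false s t) = (p ^ s * q ^ t)%:R^-1 *: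
    in_qpoly _ (\sum_(0 <= u < p ^ s * q ^ t) 'X^u).
Proof.
apply: (qcoefP n_gt0) => a an; rewrite theta_level_top // qcoefZ; congr (_ * _).
rewrite big_mkord /qcoef (in_cyclic_alg_small n_gt0).
  rewrite coef_sum (bigD1 (Ordinal an)) //= coefXn eqxx big1 ?addr0 // => u ua.
  by rewrite coefXn eq_sym (negPf ua : (u == a :> nat) = false).
apply: (leq_trans (size_sum _ _ _)); apply/bigmax_leqP => u _.
by rewrite size_polyXn.
Qed.

Lemma theta_is_theta gamma : is_theta iota alpha gamma (theta gamma).
Proof. by rewrite /theta; case: ccoset_thetaP => th []. Qed.

End PrimitiveIdempotents.

(* In (iii), the block with the row t - j - 1 is summed over s - i <= k <= s - 1
   and includes chi_(s, t - j - 1). The source prints only its k = s - i term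
   there, with which the formula is false (e.g. p = 7, q = 11, l = 2, s = 2,
   t = 1, i = 1, j = 0). *)
Theorem theorem5p7 :
  forall (s t p q l : nat) (g : int)
    (L : fieldType) (iota : {rmorphism 'F_l -> L}) (alpha : L),
  (1 <= s)%N -> (1 <= t)%N ->
  prime p -> prime q -> prime l ->
  p != q -> p != l -> q != l ->
  odd p -> odd q -> (p = 3 %[mod 4])%N ->
  is_mult_order (p ^ s) l (totient (p ^ s) %/ 2) ->
  is_mult_order (q ^ t) l (totient (q ^ t)) ->
  gcdn (totient (p ^ s)) (totient (q ^ t)) = 2%N ->
  (q%:R : 'F_p) \in quad_res p ->
  is_primitive_root_mod (p ^ s) g -> is_primitive_root_mod (q ^ t) g ->
  (p ^ s * q ^ t)%N.-primitive_root alpha ->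
  let n := (p ^ s * q ^ t)%N in
  let beta := alpha ^+ (p ^ s.-1 * q ^ t) in
  let X (i j : nat) := chi n l (p ^ i * q ^ j)%N in
  let X' (i j : nat) := chi n l ((p ^ i * q ^ j)%N%:Z * g) in
  let c : 'F_l := (p.-1 %/ 2)%:R in
  let d : 'F_l := (q.-1)%:R in
  exists (R N : 'F_l) (theta_ : int -> cyclic_alg n l),
  let theta (i j : nat) := theta_ (p ^ i * q ^ j)%N in
  let theta' (i j : nat) := theta_ ((p ^ i * q ^ j)%N%:Z * g) in
  [/\ iota R = \sum_(x in quad_res p) beta ^+ (x : nat),
      iota N = \sum_(x in quad_nonres p) beta ^+ (x : nat),
      forall gamma : int, is_theta iota alpha gamma (theta_ gamma) &
  (* (i) *)
  [/\ theta 0%N t = (p * q ^ t)%:R^-1 *: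
        (c *: (\sum_(0 <= m < t.+1) X s m)
         + N *: (\sum_(0 <= m < t.+1) X s.-1 m)
         + R *: (\sum_(0 <= m < t.+1) X' s.-1 m)) &
      theta' 0%N t = (p * q ^ t)%:R^-1 *:
        (c *: (\sum_(0 <= m < t.+1) X s m)
         + R *: (\sum_(0 <= m < t.+1) X s.-1 m)
         + N *: (\sum_(0 <= m < t.+1) X' s.-1 m))] /\
  (* (ii) *)
  (forall j : nat, (j <= t.-1)%N ->
   [/\ theta 0%N j = (p * q ^ j.+1)%:R^-1 *:
         ((c * d) *: (\sum_(t - j <= m < t.+1) X s m)
          + d *: (N *: (\sum_(t - j <= m < t.+1) X s.-1 m)
                  + R *: (\sum_(t - j <= m < t.+1) X' s.-1 m))
          - (N *: X s.-1 (t - j - 1)%N + R *: X' s.-1 (t - j - 1)%N)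
          - c *: X s (t - j - 1)%N) &
       theta' 0%N j = (p * q ^ j.+1)%:R^-1 *:
         ((c * d) *: (\sum_(t - j <= m < t.+1) X s m)
          + d *: (R *: (\sum_(t - j <= m < t.+1) X s.-1 m)
                  + N *: (\sum_(t - j <= m < t.+1) X' s.-1 m))
          - (R *: X s.-1 (t - j - 1)%N + N *: X' s.-1 (t - j - 1)%N)
          - c *: X s (t - j - 1)%N)]) /\
  (* (iii) *)
  (forall i j : nat, (1 <= i <= s.-1)%N -> (j <= t.-1)%N ->
   [/\ theta i j = (p ^ i.+1 * q ^ j.+1)%:R^-1 *:
         ((c * d) *: ((\sum_(s - i <= k < s) \sum_(t - j <= m < t.+1)
                         (X k m + X' k m))
                      + \sum_(t - j <= m < t.+1) X s m)
          + d *: (N *: (\sum_(t - j <= m < t.+1) X (s - i - 1)%N m)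
                  + R *: (\sum_(t - j <= m < t.+1) X' (s - i - 1)%N m))
          - (N *: X (s - i - 1)%N (t - j - 1)%N
             + R *: X' (s - i - 1)%N (t - j - 1)%N)
          - c *: ((\sum_(s - i <= k < s)
                     (X k (t - j - 1)%N + X' k (t - j - 1)%N))
                  + X s (t - j - 1)%N)) &
       theta' i j = (p ^ i.+1 * q ^ j.+1)%:R^-1 *:
         ((c * d) *: ((\sum_(s - i <= k < s) \sum_(t - j <= m < t.+1)
                         (X k m + X' k m))
                      + \sum_(t - j <= m < t.+1) X s m)
          + d *: (R *: (\sum_(t - j <= m < t.+1) X (s - i - 1)%N m)
                  + N *: (\sum_(t - j <= m < t.+1) X' (s - i - 1)%N m))
          - (R *: X (s - i - 1)%N (t - j - 1)%N
             + N *: X' (s - i - 1)%N (t - j - 1)%N)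
          - c *: ((\sum_(s - i <= k < s)
                     (X k (t - j - 1)%N + X' k (t - j - 1)%N))
                  + X s (t - j - 1)%N))]) /\
  (* (iv) *)
  (forall i : nat, (1 <= i <= s.-1)%N ->
   [/\ theta i t = (p ^ i.+1 * q ^ t)%:R^-1 *:
         (c *: (\sum_(s - i <= k < s) \sum_(0 <= m < t.+1) (X k m + X' k m))
          + c *: (\sum_(0 <= m < t.+1) X s m)
          + N *: (\sum_(0 <= m < t.+1) X (s - i - 1)%N m)
          + R *: (\sum_(0 <= m < t.+1) X' (s - i - 1)%N m)) &
       theta' i t = (p ^ i.+1 * q ^ t)%:R^-1 *:
         (c *: (\sum_(s - i <= k < s) \sum_(0 <= m < t.+1) (X k m + X' k m))
          + c *: (\sum_(0 <= m < t.+1) X s m)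
          + R *: (\sum_(0 <= m < t.+1) X (s - i - 1)%N m)
          + N *: (\sum_(0 <= m < t.+1) X' (s - i - 1)%N m))]) /\
  (* (v) *)
  (forall j : nat, (j <= t.-1)%N ->
     theta s j = (p ^ s * q ^ j.+1)%:R^-1 *:
       (d *: ((\sum_(0 <= k < s) \sum_(t - j <= m < t.+1) (X k m + X' k m))
              + \sum_(t - j <= m < t.+1) X s m)
        - ((\sum_(0 <= k < s) (X k (t - j - 1)%N + X' k (t - j - 1)%N))
           + X s (t - j - 1)%N))) /\
  (* (vi) *)
  [/\ theta s t = (p ^ s * q ^ t)%:R^-1 *:
        ((\sum_(0 <= k < s) \sum_(0 <= m < t.+1) (X k m + X' k m))
         + \sum_(0 <= m < t.+1) X s m) &
      theta s t = (p ^ s * q ^ t)%:R^-1 *: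
        in_qpoly _ (\sum_(0 <= u < p ^ s * q ^ t) 'X^u)]].
Proof.
move=> s t p q l g L iota alpha s_gt0 t_gt0 p_pr q_pr l_pr pq pl _ _ _ p34.
move=> ord_p ord_q gcd_tot q_res g_p g_q alpha_prim n beta X X' c d.
have pred_lt a b : (0 < b)%N -> (a <= b.-1)%N -> (a < b)%N.
  by move=> b_gt0; rewrite -ltnS prednK.
pose rho := period_Fp s_gt0 p_pr p34 ord_p iota l_pr pl alpha_prim.
have rhoE : forall e, iota (rho e) = period p beta e.
  exact: iota_period_Fp.
(* R and N are the values of [rho] at false and true; so [~~ e] puts N on the unstarred sums for e =
   false, and R for e = true. *)
exists (rho false), (rho true), (theta iota l_pr alpha_prim).
split.
- rewrite rhoE; apply: eq_bigl => x.
  by rewrite (mem_quad_res p_pr p34) expr0.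
- rewrite rhoE; apply: eq_bigl => x.
  by rewrite (mem_quad_nonres p_pr p34) expr1.
- exact: theta_is_theta.
have F1 := theta_0_top s_gt0 t_gt0 p_pr q_pr pq p34 ord_p ord_q gcd_tot q_res
  iota l_pr pl g_p g_q alpha_prim.
have F2 := theta_0 s_gt0 t_gt0 p_pr q_pr pq p34 ord_p ord_q gcd_tot q_res
  iota l_pr pl g_p g_q alpha_prim.
have F3 := theta_mid s_gt0 t_gt0 p_pr q_pr pq p34 ord_p ord_q gcd_tot q_res
  iota l_pr pl g_p g_q alpha_prim.
have F4 := theta_mid_top s_gt0 t_gt0 p_pr q_pr pq p34 ord_p ord_q gcd_tot q_res
  iota l_pr pl g_p g_q alpha_prim.
have F5 := theta_s s_gt0 t_gt0 p_pr q_pr pq p34 ord_p ord_q gcd_tot q_res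
  iota l_pr g_p g_q alpha_prim.
have F6 := theta_s_top s_gt0 t_gt0 p_pr q_pr pq p34 ord_p ord_q gcd_tot q_res
  iota l_pr g_p g_q alpha_prim.
have F7 := theta_s_top_all_powers
  s_gt0 t_gt0 p_pr q_pr pq p34 ord_p ord_q gcd_tot q_res
  iota l_pr g_p g_q alpha_prim.
split; first by split; [exact: (F1 false) | exact: (F1 true)].
split.
  move=> j /(pred_lt _ _ t_gt0) lt_jt.
  by split; [exact: (F2 false) | exact: (F2 true)].
split.
  move=> i j /andP [i_gt0 /(pred_lt _ _ s_gt0) lt_is].
  move=> /(pred_lt _ _ t_gt0) lt_jt.
  have i_in : (0 < i < s)%N by rewrite i_gt0.
  by split; [exact: (F3 false) | exact: (F3 true)].
split.
  move=> i /andP [i_gt0 /(pred_lt _ _ s_gt0) lt_is].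
  have i_in : (0 < i < s)%N by rewrite i_gt0.
  by split; [exact: (F4 false) | exact: (F4 true)].
split; last by split; [exact: F6 | exact: F7].
by move=> j /(pred_lt _ _ t_gt0) lt_jt; exact: F5.
Qed.
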